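(* Let $\lambda>0$, let $w=p/q\in(0,1)$ with $p,q$ relatively prime positive integers, and let $k\ge 2$ be an integer. Let $\Pi$ be a homogeneous Poisson point process of intensity $\lambda$ on $(0,1]$, and let $\alpha$, $\beta_n$, $\nu(\Pi)$, $\tilde\nu(\Pi)$ be as defined in the context. Then, as $n\to\infty$ along $n=mq$ $(m=1,2,\dots)$, $$\lim_{n\to\infty}\frac{2n}{\lambda^2}(\alpha-\beta_n)=\frac{1}{\lambda}\,\mathbb{E}\left[\nu(\Pi)+\tilde\nu(\Pi)\right]+\alpha-\int_0^1\mathbb{P}\left(\max_{0\le t\le 1-w}\left|(\Pi\cup\{u\})\cap(t,t+w]\right|\ge k\right)du.$$
   Context: $|\cdot|$ denotes the number of points of a (multi)set, counted with multiplicity. The continuous scan statistic is $S_w=S_w(\Pi):=\max_{0\le t\le 1-w}|\Pi\cap(t,t+w]|$, and $\alpha:=\mathbb{P}(S_w\ge k)$. For $n=mq$ (so that $nw$ is an integer) with $n\ge\lambda$, let $H^n_1,\dots,H^n_n$ be i.i.d. with $\mathbb{P}(H^n_i=1)=\lambda/n$ and $\mathbb{P}(H^n_i=0)=1-\lambda/n$. Put $\beta_n:=\mathbb{P}\left(\max_{i=1,\dots,n-nw+1}\sum_{r=i}^{i+nw-1}H^n_r\ge k\right)$. Let $M:=|\Pi|$ (Poisson with mean $\lambda$) and write $\Pi=\{Q_1,\dots,Q_M\}$. Almost surely $0<Q_1<\cdots<Q_M<1$, $w\notin\Pi$, $1-w\notin\Pi$, and $Q_j-Q_i\ne w$ for all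 $1\le i<j\le M$; the following functionals are defined on this almost sure event: $$\nu(\Pi):=\sum_{\{\ell:\,Q_\ell<1-w\}}\mathbf{1}\Big\{S_w<k,\ |\Pi\cap(Q_\ell,Q_\ell+w]|=k-2,\ |\Pi\cap(t,t+w]|\le k-2\text{ for all }t\text{ with }Q_\ell\le t\le Q_\ell+w\Big\},$$ $$\tilde\nu(\Pi):=\sum_{\ell=1}^M\mathbf{1}\Big\{S_w<k,\ \max_{0\le t\le 1-w}|(\Pi\cup\{Q_\ell\})\cap(t,t+w]|=k\Big\},$$ where $\Pi\cup\{Q_\ell\}$ is interpreted as a multiset in which $Q_\ell$ has multiplicity $2$. *)

(* Defs.v *)
From HB Require Import structures.
From mathcomp Require Import all_boot all_order all_algebra.
From mathcomp Require Import all_classical all_reals all_analysis.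

Set Implicit Arguments.
Unset Strict Implicit.
Unset Printing Implicit Defensive.

Import Order.TTheory GRing.Theory Num.Theory.
Import numFieldNormedType.Exports.

Local Open Scope classical_set_scope.
Local Open Scope ring_scope.

(* Product rule for the whole family; taking A i = setT outside a subfamily
   gives the product rule for that subfamily. *)
Definition mutually_independent d d' (T : measurableType d)
    (T' : measurableType d') (R : realType) (P : probability T R)
    (I : finType) (X : I -> T -> T') : Prop :=
  forall A : I -> set T', (forall i, measurable (A i)) ->
    P (\bigcap_i (X i @^-1` A i)) = (\prod_i P (X i @^-1` A i))%E.

(* A finite multiset of reals is encoded as a list of its points with
   repetitions; the order of the list is irrelevant everywhere below, and
   x :: s stands for the multiset obtained by adding one more copy of x. *)
Definition num_points (R : realType) (B : set R) (s : seq R) : nat :=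
  count (fun x => `[< B x >]) s.

Definition in_window (R : realType) (w : R) (s : seq R) (t : R) : nat :=
  num_points `]t, (t + w)] s.

(* The largest of the values attained by in_window w s on [0, 1 - w], all of
   which are at most size s. *)
Definition scan (R : realType) (w : R) (s : seq R) : nat :=
  \max_(j < (size s).+1 |
        `[< exists2 t : R, 0 <= t <= 1 - w & in_window w s t = j >]) j.

Lemma in_window_le_scan (R : realType) (w : R) (s : seq R) (t : R) :
  0 <= t <= 1 - w -> (in_window w s t <= scan w s)%N.
Proof.
move=> tw; have sz : (in_window w s t < (size s).+1)%N by rewrite ltnS count_size.
rewrite /scan; apply: (leq_trans _ (@leq_bigmax_cond _ _ _ (Ordinal sz) _)) => //.
by apply/asboolP; exists t.
Qed.

Lemma scan_attained (R : realType) (w : R) (s : seq R) : w <= 1 ->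
  exists2 t : R, 0 <= t <= 1 - w & in_window w s t = scan w s.
Proof.
move=> w1; have t0 : 0 <= (0 : R) <= 1 - w by rewrite lexx subr_ge0.
have sz : (in_window w s 0 < (size s).+1)%N by rewrite ltnS count_size.
pose p (j : 'I_(size s).+1) :=
  `[< exists2 t : R, 0 <= t <= 1 - w & in_window w s t = j >].
have /(@eq_bigmax_cond _ p (fun j => nat_of_ord j)) [j pj jE] : (0 < #|p|)%N.
  by apply/card_gt0P; exists (Ordinal sz); apply/asboolP; exists 0.
by have /asboolP[t tw tE] := pj; exists t => //; rewrite tE /scan -jE.
Qed.

(* Homogeneous Poisson point process of intensity lambda on (0, 1]; the second
   argument of poisson_prob is a dummy. *)
Record poisson_process d (T : measurableType d) (R : realType)
    (P : probability T R) (lambda : R) (Pi : T -> seq R) : Prop := {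
  pp_support : forall x, {in Pi x, forall y, 0 < y <= 1} ;
  pp_measurable : forall B : set R, measurable B ->
    measurable_fun setT (fun x => num_points B (Pi x)) ;
  pp_poisson : forall B : set R, measurable B -> B `<=` `]0, 1] ->
    forall U : set nat,
    P [set x | U (num_points B (Pi x))] =
    poisson_prob (lambda * fine (lebesgue_measure B)) 0 U ;
  pp_independent : forall (n : nat) (B : 'I_n -> set R),
    (forall i, measurable (B i)) -> (forall i, B i `<=` `]0, 1]) ->
    trivIset setT B ->
    mutually_independent P (fun i x => num_points (B i) (Pi x)) }.

Definition alpha d (T : measurableType d) (R : realType)
    (P : probability T R) (Pi : T -> seq R) (w : R) (k : nat) : \bar R :=
  P [set x | (k <= scan w (Pi x))%N].

(* h 1, ..., h n are i.i.d. Bernoulli with success probability a. *)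
Record iid_bernoulli d (T : measurableType d) (R : realType)
    (P : probability T R) (n : nat) (a : R) (h : nat -> T -> nat) : Prop := {
  ib_measurable : forall i, (0 < i <= n)%N -> measurable_fun setT (h i) ;
  ib_one : forall i, (0 < i <= n)%N -> P [set x | h i x = 1%N] = a%:E ;
  ib_zero : forall i, (0 < i <= n)%N -> P [set x | h i x = 0%N] = (1 - a)%:E ;
  ib_independent : mutually_independent P (fun i : 'I_n => h i.+1) }.

(* nw is the window length, i.e. the natural number n * w. *)
Definition beta d (T : measurableType d) (R : realType)
    (P : probability T R) (n nw k : nat) (h : nat -> T -> nat) : \bar R :=
  P [set x | (k <= \max_(1 <= i < (n - nw).+2)
                     \sum_(i <= r < i + nw) h r x)%N].

Definition nu (R : realType) (w : R) (k : nat) (s : seq R) : nat :=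
  (\sum_(Q <- s | (Q < 1 - w)%R)
    [&& scan w s < k, in_window w s Q == k - 2 &
        `[< forall t : R, (Q <= t <= Q + w)%R -> in_window w s t <= k - 2 >]])%N.

Definition nu_tilde (R : realType) (w : R) (k : nat) (s : seq R) : nat :=
  (\sum_(Q <- s) ((scan w s < k) && (scan w (Q :: s) == k)))%N.

(* Main.v *)
Require Import Defs.
From HB Require Import structures.
From mathcomp Require Import all_boot all_order all_algebra.
From mathcomp Require Import all_classical all_reals all_analysis measurable_realfun.
From mathcomp Require Import zify ring lra.
Set Implicit Arguments.
Unset Strict Implicit.
Unset Printing Implicit Defensive.
Import Order.TTheory GRing.Theory Num.Theory.
Import numFieldNormedType.Exports.
Local Open Scope classical_set_scope.
Local Open Scope ring_scope.

(** Cut (0, 1] into n = mq cells of length 1/n, so that the scanning window has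
    the length of exactly L = mp cells, and let A_n be the probability that some
    L consecutive cells contain k cells occupied by Pi.  The occupied cells form
    an i.i.d. Bernoulli family with parameter 1 - exp(-lambda/n) ([occ_law]).
    Write alpha - beta_n = (alpha - A_n) + (A_n - beta_n); both terms are of order
    1/n, and they produce the two parts of the limit.

    In A_n - beta_n the same event is compared under two Bernoulli parameters
    whose difference is - lambda^2 / (2 n^2) + O(n^-3).  Russo's formula
    ([bernE_russo]) multiplies this difference by the sum over the sites of the
    effect of forcing one site to be occupied.  The average over the sites of the
    probability with one forced site tends to the integral over u of the
    probability that Pi with u added is crowded ([mean_cons_cvg]); hence the terms
    alpha and - int of the limit ([grid_beta_cvg]).

    For alpha - A_n it is enough to know A_2n - A_n: since A_(2^j n) tends to
    alpha, a telescoping sum over j turns A_2n - A_n ~ c/n into alpha - A_n ~ 2c/n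
    ([halving_limit]).  The two events behind A_2n and A_n concern the same points
    and can differ only if two points lie in one coarse cell, or if two points lie
    in fine cells at distance 2L - 1 whose coarse cells are at distance L: these
    points are closer than w although the coarse grid separates them.  Each of the
    2n places for such a bad pair has probability O(n^-2), and two bad pairs occur
    together with probability O(n^-2) in total ([bernE_double_bad]); up to O(n^-2),
    A_2n - A_n is therefore the sum over the places of the probability that a
    single bad pair decides the event ([defect_approx], [grid_scan_refine]).  A
    one-site Mecke formula ([bernE_mem]) rewrites this sum as an expected sum over
    the occupied coarse cells, [total_gain]: pairs inside one cell give the summands
    of nu_tilde, where a point is doubled, and pairs at distance L give those of nu,
    where a point is added at the very end of a window.  A bad pair has probability
    b^2 with b ~ lambda / (2n), and reading one of its cells as an occupied coarse
    cell divides by a ~ lambda / n; hence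
    n (A_2n - A_n) -> (lambda / 4) E(nu + nu_tilde) ([refinement_cvg]).

    All limits of expectations are taken in the same way.  Almost surely no two
    points of Pi are at distance 0, w or 2w ([negligible_nongeneric]); then, from
    some n on, comparisons of cells agree with comparisons of points
    ([generic_resolves], [cell_lt_shift]), so that every grid functional is
    eventually equal to its continuous counterpart, and all of them are bounded. *)

(** * Crowded lists and the effect of halving the mesh *)

(** The window is anchored at one of its own points.  In this form crowding depends
    only on the comparisons [near], so it can be carried from real points to the
    indices of their cells. *)
Definition crowded (T : Type) (near : rel T) (k : nat) (s : seq T) : bool :=
  has (fun x => k <= count (near x) s)%N s.

Definition nearn (L : nat) : rel nat := fun i j => (i <= j < i + L)%N.

Lemma crowded_map (T T' : eqType) (f : T -> T') (near : rel T) (near' : rel T')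
    (k : nat) (s : seq T) :
  {in s &, forall x y, near' (f x) (f y) = near x y} ->
  crowded near' k (map f s) = crowded near k s.
Proof.
move=> nearE; rewrite /crowded has_map; apply: eq_in_has => x xs /=.
by rewrite count_map; congr (k <= _)%N; apply: eq_in_count => y ys /=; exact: nearE.
Qed.

Lemma eq_crowded (T : eqType) (near near' : rel T) (k : nat) (s : seq T) :
  {in s &, near =2 near'} -> crowded near k s = crowded near' k s.
Proof. by move=> e; rewrite -[s in RHS]map_id (@crowded_map _ _ id near) // => x y xs ys; rewrite e. Qed.

Lemma crowded_perm (T : eqType) (near : rel T) (k : nat) (s t : seq T) :
  perm_eq s t -> crowded near k s = crowded near k t.
Proof.
move=> st; rewrite /crowded (eq_has_r (perm_mem st)).
by apply: eq_has => x /=; rewrite (permP st).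
Qed.

Lemma crowded_cons (T : Type) (near : rel T) (k : nat) (x : T) (s : seq T) :
  crowded near k s -> crowded near k (x :: s).
Proof.
rewrite /crowded /= => H; apply/orP; right; apply: sub_has H => y /=.
by move=> /leq_trans; apply; rewrite leq_addl.
Qed.

(** Fine sites are halved to coarse ones, and two occupied sites u < partner L u are
    what the coarse configuration can get wrong.  For even u the partner is the
    sibling in the same coarse cell, which halving merges with u.  For odd u it is the
    only later site at distance less than 2L whose coarse cell is at distance L. *)
Definition partner (L u : nat) : nat :=
  if odd u then (u + L.*2).-1 else u.+1.

Definition bad_pair (L : nat) (e : seq nat) (u : nat) : bool :=
  (u \in e) && (partner L u \in e).

(** With c the coarse configuration and u the only site occupied together with its
    partner, [gain] says that this pair makes the fine configuration crowded although
    c is not.  For even u the coarse site u./2 has to be counted twice; for odd u the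
    window anchored at u./2 has to be extended by one more site. *)
Definition gain (L k u : nat) (c : seq nat) : bool :=
  ~~ crowded (nearn L) k c &&
  (if odd u then k <= (count (nearn L u./2) c).+1
   else crowded (nearn L) k (u./2 :: c))%N.

Definition nearh (L : nat) : rel nat := fun u v => nearn L u./2 v./2.

Lemma nearn_fine (L u v : nat) : (0 < L)%N ->
  (u./2 != v./2) || (u <= v)%N -> (odd u -> v != partner L u) ->
  nearn L.*2 u v = nearh L u v.
Proof. by rewrite /nearh /nearn /partner; case: ifP => ou L0 uv h; [have := h isT|]; lia. Qed.

Section refine.
Variables (L k : nat) (e c : seq nat).
Hypotheses (L_gt0 : (0 < L)%N) (eU : uniq e) (cU : uniq c).
Hypothesis c_half : c =i map half e.

Lemma half_inj : (forall u, ~~ odd u -> ~~ bad_pair L e u) ->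
  {in e &, injective half}.
Proof.
move=> nb u v ue ve uv; case: (ltngtP u v) => // uv'.
- have ou : ~~ odd u by lia.
  have := nb u ou; rewrite /bad_pair ue /partner (negbTE ou).
  have -> : u.+1 = v by lia.
  by rewrite ve /=.
- have ov : ~~ odd v by lia.
  have := nb v ov; rewrite /bad_pair ve /partner (negbTE ov).
  have -> : v.+1 = u by lia.
  by rewrite ue /=.
Qed.

Lemma perm_half : (forall u, ~~ odd u -> ~~ bad_pair L e u) ->
  perm_eq c (map half e).
Proof.
move=> nb; apply: uniq_perm => //; rewrite map_inj_in_uniq //; exact: half_inj.
Qed.

Lemma crowded_refine0 : (forall u, ~~ bad_pair L e u) ->
  crowded (nearn L.*2) k e = crowded (nearn L) k c.
Proof.
move=> nb; rewrite (crowded_perm _ _ (perm_half (fun u _ => nb u))).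
rewrite (@crowded_map _ _ half (nearh L)) //.
apply: eq_crowded => u v ue ve; apply: nearn_fine => //.
  rewrite -implybE; apply/implyP => /eqP /half_inj -> //.
by move=> _; apply: contraNneq (nb u) => vE; rewrite /bad_pair ue -vE.
Qed.

(** With a single bad pair starting at an odd site, halving is injective on e and
    only the count of the window anchored at u changes, by one. *)
Lemma crowded_refine_odd u : odd u -> bad_pair L e u ->
  (forall v, bad_pair L e v -> v = u) ->
  crowded (nearn L.*2) k e = crowded (nearn L) k c || gain L k u c.
Proof.
move=> ou bu nb.
have nb' v : ~~ odd v -> ~~ bad_pair L e v.
  by move=> ov; apply/negP => /nb vu; rewrite vu ou in ov.
have inj := half_inj nb'.
have [ue pe] := andP bu.
have cE := crowded_perm (nearn L) k (perm_half nb').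
have cntE : count (nearn L u./2) c = count (nearh L u) e.
  by rewrite (permP (perm_half nb')) count_map.
have near_ne x : x \in e -> x != u ->
    count (nearn L.*2 x) e = count (nearh L x) e.
  move=> xe xu; apply: eq_in_count => v ve; apply: nearn_fine => //.
    by rewrite -implybE; apply/implyP => /eqP /inj -> //.
  move=> _; apply: contraNneq xu => vE; apply/eqP/nb.
  by rewrite /bad_pair xe -vE.
have near_u : count (nearn L.*2 u) e = (count (nearh L u) e).+1.
  have nearE : {in e, nearn L.*2 u =1 predU (nearh L u) (pred1 (partner L u))}.
    move=> v ve /=; have [->|vp] := eqVneq v (partner L u).
      by rewrite orbT /nearn /partner ou; lia.
    rewrite orbF; apply: nearn_fine => //.
    by rewrite -implybE; apply/implyP => /eqP /inj -> //.
  rewrite (eq_in_count nearE).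
  have := count_predUI (nearh L u) (pred1 (partner L u)) e.
  rewrite [in RHS]count_uniq_mem // pe addn1 => <-.
  rewrite -[LHS]addn0; congr addn; apply/esym/eqP.
  rewrite -leqn0 leqNgt -has_count; apply/hasPn => v _ /=.
  by rewrite /nearh /nearn /partner ou; lia.
have crE : crowded (nearn L.*2) k e =
    crowded (nearn L) k c || (k <= (count (nearn L u./2) c).+1)%N.
  rewrite cE (@crowded_map _ _ half (nearh L)) // cntE -near_u.
  apply/idP/orP.
    case/hasP => x xe kx; have [xu|xu] := eqVneq x u; first by right; rewrite -xu.
    by left; apply/hasP; exists x => //; rewrite -near_ne.
  case=> [/hasP[x xe kx]|ku]; last by apply/hasP; exists u.
  apply/hasP; exists x => //; have [xu|xu] := eqVneq x u.
    by move: kx; rewrite xu near_u; exact: leqW.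
  by rewrite near_ne.
by rewrite crE /gain ou; case: (crowded (nearn L) k c).
Qed.

(** With a single bad pair of siblings, e is the list u./2 :: c up to the choice of
    the fine positions.  The comparisons differ only at the anchor u.+1, where the
    fine count is the smaller one; the anchor u compensates for it. *)
Lemma crowded_refine_even u : ~~ odd u -> bad_pair L e u ->
  (forall v, bad_pair L e v -> v = u) ->
  crowded (nearn L.*2) k e = crowded (nearn L) k c || gain L k u c.
Proof.
move=> ou bu nb; have [ue] := andP bu; rewrite /partner (negbTE ou) => pe.
have permE : perm_eq (u./2 :: c) (map half e).
  have re := perm_to_rem pe.
  rewrite perm_sym; apply: perm_trans (perm_map half re) _.
  rewrite /= (_ : uphalf u = u./2); last by lia.
  rewrite perm_cons perm_sym; apply: uniq_perm => //.
    rewrite map_inj_in_uniq ?rem_uniq // => x y.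
    rewrite !mem_rem_uniq // !inE => /andP[xu xe] /andP[yu ye] xy.
    case: (ltngtP x y) => // xy'.
      have xu' : x = u.
        apply: nb; rewrite /bad_pair xe /partner ifN ?inE; last by lia.
        have -> : x.+1 = y by lia.
        by [].
      lia.
    have yu' : y = u.
      apply: nb; rewrite /bad_pair ye /partner ifN ?inE; last by lia.
      have -> : y.+1 = x by lia.
      by [].
    lia.
  move=> i; rewrite c_half; apply/mapP/mapP => -[x xe ->].
    have [->|xu] := eqVneq x u.+1.
      exists u; last by lia.
      by rewrite mem_rem_uniq // !inE ue andbT; lia.
    by exists x => //; rewrite mem_rem_uniq // !inE xu.
  by exists x => //; exact: mem_rem xe.
have nearE x v : x \in e -> v \in e -> nearn L.*2 x v -> nearh L x v.
  move=> xe ve xv; rewrite -nearn_fine //; first by move: xv; rewrite /nearn; lia.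
  move=> ox; apply: contraNneq ou => vE.
  by rewrite -(nb x) // /bad_pair xe -vE.
have nearE' x v : x \in e -> v \in e -> x != u.+1 -> nearn L.*2 x v = nearh L x v.
  move=> xe ve xu; apply/idP/idP; first exact: nearE.
  move=> xv; rewrite nearn_fine //.
    rewrite -implybE; apply/implyP => /eqP xv2.
    rewrite leqNgt; apply: contraNN xu => vx; apply/eqP.
    have ov : ~~ odd v by lia.
    have vu : v = u.
      apply: nb; rewrite /bad_pair ve /partner (negbTE ov).
      by rewrite (_ : v.+1 = x) //; lia.
    by lia.
  move=> ox; apply: contraNneq ou => vE.
  by rewrite -(nb x) // /bad_pair xe -vE.
have crE : crowded (nearn L.*2) k e = crowded (nearn L) k (u./2 :: c).
  rewrite (crowded_perm _ _ permE) (@crowded_map _ _ half (nearh L)) //.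
  have le x : x \in e -> (count (nearn L.*2 x) e <= count (nearh L x) e)%N.
    move=> xe; rewrite -!size_filter; apply: uniq_leq_size; first exact: filter_uniq.
    by move=> v; rewrite !mem_filter => /andP[xv ve]; rewrite ve nearE.
  apply/hasP/hasP => -[x xe kx]; first by exists x => //; exact: leq_trans (le _ xe).
  have [xu|xu] := eqVneq x u.+1; last first.
    by exists x => //; rewrite (eq_in_count (a2 := nearh L x)) // => v ve; exact: nearE'.
  exists u => //; rewrite (eq_in_count (a2 := nearh L u)); last first.
    by move=> v ve; apply: nearE' => //; lia.
  by move: kx; rewrite xu /nearh; have -> : u.+1./2 = u./2 by lia.
rewrite crE /gain (negbTE ou).
by have := @crowded_cons _ (nearn L) k u./2 c; case: (crowded _ _ c) => // ->.
Qed.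

End refine.

(** * Expectations over independent Bernoulli sites *)

Definition sites (n : nat) (c : {set 'I_n}) : seq nat := [seq val i | i <- enum c].

Lemma sites_uniq n (c : {set 'I_n}) : uniq (sites c).
Proof. by rewrite map_inj_uniq ?enum_uniq //; exact: val_inj. Qed.

Lemma mem_sites n (c : {set 'I_n}) (i : 'I_n) : (val i \in sites c) = (i \in c).
Proof. by rewrite mem_map ?mem_enum //; exact: val_inj. Qed.

Lemma sites_lt n (c : {set 'I_n}) (i : nat) : i \in sites c -> (i < n)%N.
Proof. by case/mapP => j _ ->; exact: ltn_ord. Qed.

Lemma perm_sites n (c : {set 'I_n}) (s : seq nat) : uniq s ->
  (forall i, i \in s -> (i < n)%N) -> (forall i : 'I_n, (i \in c) = (val i \in s)) ->
  perm_eq (sites c) s.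
Proof.
move=> sU sn cs; apply: uniq_perm => //; first exact: sites_uniq.
move=> i; apply/idP/idP => [|si].
  by case/mapP => j; rewrite mem_enum cs => js ->.
have i_n := sn _ si; have := cs (Ordinal i_n).
by rewrite -mem_sites /= si.
Qed.

Section bernoulli_sums.
Variables (R : realFieldType) (n : nat).
Implicit Types (th : 'I_n -> R) (c : {set 'I_n}) (F G : {set 'I_n} -> R).

Definition bernw th c : R := \prod_i (if i \in c then th i else 1 - th i).

(** The expectation of F (c) when the sites of c are independent and site i is
    occupied with probability th i; the law of a grid configuration enters the proof
    only through this finite sum. *)
Definition bernE th F : R := \sum_c bernw th c * F c.

Lemma eq_bernE th F G : F =1 G -> bernE th F = bernE th G.
Proof. by move=> FG; apply: eq_bigr => c _; rewrite FG. Qed.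

Lemma bernE_cst th (x : R) : bernE th (fun=> x) = x.
Proof.
rewrite /bernE -mulr_suml -[RHS]mul1r; congr (_ * _).
rewrite -[LHS](bigA_distr _ _ _) /=; apply: big1 => i _; lra.
Qed.

Lemma bernE_sum th (I : Type) (r : seq I) (Q : pred I) (F : I -> {set 'I_n} -> R) :
  bernE th (fun c => \sum_(i <- r | Q i) F i c) =
  \sum_(i <- r | Q i) bernE th (F i).
Proof.
rewrite /bernE exchange_big /=; apply: eq_bigr => c _; exact: mulr_sumr.
Qed.

Lemma bernEZ th (x : R) F : bernE th (fun c => x * F c) = x * bernE th F.
Proof. by rewrite /bernE mulr_sumr; apply: eq_bigr => c _; rewrite mulrCA. Qed.

Lemma bernED th F G : bernE th (fun c => F c + G c) = bernE th F + bernE th G.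
Proof. by rewrite /bernE -big_split; apply: eq_bigr => c _; rewrite mulrDr. Qed.

Lemma bernEB th F G : bernE th (fun c => F c - G c) = bernE th F - bernE th G.
Proof. by rewrite /bernE -sumrB; apply: eq_bigr => c _; rewrite mulrBr. Qed.

Lemma bernw_ge0 th c : (forall i, 0 <= th i <= 1) -> 0 <= bernw th c.
Proof.
by move=> th01; apply: prodr_ge0 => i _; case: ifP => _; have := th01 i; lra.
Qed.

Lemma le_bernE th F G : (forall i, 0 <= th i <= 1) -> (forall c, F c <= G c) ->
  bernE th F <= bernE th G.
Proof.
by move=> th01 FG; apply: ler_sum => c _; apply: ler_wpM2l => //; exact: bernw_ge0.
Qed.

Lemma ler_norm_bernE th F G : (forall i, 0 <= th i <= 1) ->
  (forall c, `|F c| <= G c) -> `|bernE th F| <= bernE th G.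
Proof.
move=> th01 FG; apply: le_trans (ler_norm_sum _ _ _) _; apply: ler_sum => c _.
by rewrite normrM ger0_norm ?bernw_ge0 // ler_wpM2l ?bernw_ge0.
Qed.

Definition bernw_off th (i : 'I_n) c : R :=
  \prod_(j | j != i) (if j \in c then th j else 1 - th j).

Lemma bernE_site th (i : 'I_n) F :
  bernE th F = \sum_(c : {set 'I_n} | i \notin c) bernw_off th i c *
    (th i * F (i |: c) + (1 - th i) * F c).
Proof.
rewrite /bernE (bigID (fun c : {set 'I_n} => i \notin c)) /= addrC.
rewrite (reindex_onto (fun c : {set 'I_n} => i |: c) (fun c => c :\ i)) /=; last first.
  by move=> c; rewrite negbK => ic; rewrite finset.setD1K.
rewrite (eq_bigl (fun c : {set 'I_n} => i \notin c)); last first.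
  move=> c; rewrite negbK finset.setU11 /=; apply/eqP/idP => [<-|ic].
    by rewrite !inE eqxx.
  by rewrite finset.setU1K.
rewrite -big_split /=; apply: eq_bigr => c ic; rewrite mulrDr; congr (_ + _).
  rewrite mulrCA mulrA; congr (_ * _); rewrite /bernw (bigD1 i) //= finset.setU11.
  by congr (_ * _); apply: eq_bigr => j ji; rewrite !inE (negbTE ji).
by rewrite mulrCA mulrA; congr (_ * _); rewrite /bernw (bigD1 i) //= (negbTE ic).
Qed.

Lemma bernE_setU1 th (i : 'I_n) F :
  bernE th (fun c => F (i |: c)) = \sum_(c : {set 'I_n} | i \notin c) bernw_off th i c * F (i |: c).
Proof.
rewrite (bernE_site _ i); apply: eq_bigr => c _; congr (_ * _).
by rewrite finset.setUA finset.setUid; lra.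
Qed.

Lemma bernE_setD1 th (i : 'I_n) F :
  bernE th (fun c => F (c :\ i)) = \sum_(c : {set 'I_n} | i \notin c) bernw_off th i c * F c.
Proof.
rewrite (bernE_site _ i); apply: eq_bigr => c ic; congr (_ * _).
rewrite finset.setU1K // (_ : c :\ i = c); first by lra.
by apply/finset.setDidPl; rewrite disjoint_sym disjoints1.
Qed.

Lemma bernE_total th (i : 'I_n) F : bernE th F =
  th i * bernE th (fun c => F (i |: c)) + (1 - th i) * bernE th (fun c => F (c :\ i)).
Proof.
rewrite bernE_setU1 bernE_setD1 (bernE_site _ i) !mulr_sumr -big_split /=.
by apply: eq_bigr => c _; ring.
Qed.

(** A one-site Mecke formula. *)
Lemma bernE_mem th (i : 'I_n) F :
  bernE th (fun c => (i \in c)%:R * F c) = th i * bernE th (fun c => F (i |: c)).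
Proof.
rewrite bernE_setU1 (bernE_site _ i) mulr_sumr; apply: eq_bigr => c ic.
by rewrite finset.setU11 (negbTE ic) mulr1n mulr0n; ring.
Qed.

Lemma bernw_off_eq th th' (i : 'I_n) c : (forall j, j != i -> th j = th' j) ->
  bernw_off th i c = bernw_off th' i c.
Proof. by move=> e; apply: eq_bigr => j ji; rewrite e. Qed.

Lemma bernE_change1 th th' (i : 'I_n) F : (forall j, j != i -> th j = th' j) ->
  bernE th' F - bernE th F =
  (th' i - th i) * (bernE th (fun c => F (i |: c)) - bernE th (fun c => F (c :\ i))).
Proof.
move=> e; rewrite bernE_setU1 bernE_setD1 !(bernE_site _ i) -!sumrB mulr_sumr.
by apply: eq_bigr => c _; rewrite (bernw_off_eq _ e); ring.
Qed.

(** Consecutive hybrids differ at one site, where [bernE_change1] applies. *)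
Definition hybrid th th' (j : nat) : 'I_n -> R :=
  fun i => if (i < j)%N then th' i else th i.

Lemma bernE_telescope th th' F : bernE th' F - bernE th F =
  \sum_j (th' j - th j) * (bernE (hybrid th th' j) (fun c => F (j |: c)) -
                           bernE (hybrid th th' j) (fun c => F (c :\ j))).
Proof.
pose u j := bernE (hybrid th th' j) F.
have -> : bernE th' F - bernE th F = u n - u 0%N.
  congr (_ - _); apply: eq_bigr => c _; congr (_ * _); apply: eq_bigr => i _.
  by rewrite /hybrid ltn_ord.
rewrite -(telescope_sumr _ (leq0n n)) big_mkord; apply: eq_bigr => j _.
rewrite /u (@bernE_change1 (hybrid th th' j) _ j).
  by rewrite /hybrid ltnn ltnSn.
by move=> i ij; rewrite /hybrid ltnS [in RHS]leq_eqVlt val_eqE (negbTE ij).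
Qed.

Lemma hybrid01 th th' j : (forall i, 0 <= th i <= 1) -> (forall i, 0 <= th' i <= 1) ->
  forall i, 0 <= hybrid th th' j i <= 1.
Proof. by move=> h h' i; rewrite /hybrid; case: ifP. Qed.

Lemma bernE_itv01 th F : (forall i, 0 <= th i <= 1) -> (forall c, 0 <= F c <= 1) ->
  0 <= bernE th F <= 1.
Proof.
move=> th01 F01; rewrite -{1}(bernE_cst th 0) -(bernE_cst th 1).
by apply/andP; split; apply: le_bernE => // c; case/andP: (F01 c).
Qed.

Lemma bernE_lipschitz th th' F : (forall i, 0 <= th i <= 1) ->
  (forall i, 0 <= th' i <= 1) -> (forall c, 0 <= F c <= 1) ->
  `|bernE th' F - bernE th F| <= \sum_i `|th' i - th i|.
Proof.
move=> h h' F01; rewrite bernE_telescope; apply: le_trans (ler_norm_sum _ _ _) _.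
apply: ler_sum => j _; rewrite normrM -[leRHS]mulr1 ler_wpM2l //.
have h2 := hybrid01 j h h'.
have /andP[a0 a1] := bernE_itv01 h2 (fun c => F01 (j |: c)).
have /andP[b0 b1] := bernE_itv01 h2 (fun c => F01 (c :\ j)).
by rewrite ler_norml; lra.
Qed.

(** Russo's formula as a first-order expansion: in [bernE_telescope] each hybrid law
    is replaced by the Bernoulli law of parameter a', and the removal of a site by no
    change at all.  The first replacement costs n |a' - a| by [bernE_lipschitz], the
    second at most a', the probability that the site is occupied. *)
Lemma bernE_russo (a a' : R) F : 0 <= a <= 1 -> 0 <= a' <= 1 ->
  (forall c, 0 <= F c <= 1) ->
  `|bernE (fun=> a') F - bernE (fun=> a) F -
    (a' - a) * (\sum_i bernE (fun=> a') (fun c => F (i |: c)) -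
                n%:R * bernE (fun=> a') F)| <=
  `|a' - a| * (n%:R * (2 * n%:R * `|a' - a| + a')).
Proof.
move=> ha ha' F01; rewrite bernE_telescope /= -mulr_sumr -mulrBr normrM ler_wpM2l //.
have -> : n%:R * bernE (fun=> a') F = \sum_(i < n) bernE (fun=> a') F.
  by rewrite sumr_const card_ord mulr_natl.
rewrite -!sumrB; apply: le_trans (ler_norm_sum _ _ _) _.
apply: (@le_trans _ _ (\sum_(i < n) (2 * n%:R * `|a' - a| + a'))); last first.
  by rewrite sumr_const card_ord -[leLHS]mulr_natl.
apply: ler_sum => j _; set th := hybrid _ _ _.
have lip G : (forall c, 0 <= G c <= 1) ->
    `|bernE th G - bernE (fun=> a') G| <= n%:R * `|a' - a|.
  move=> G01; apply: le_trans (bernE_lipschitz (th := fun=> a') (th' := th) _ _ G01) _.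
  - by [].
  - exact: hybrid01.
  have -> : n%:R * `|a' - a| = \sum_(i < n) `|a' - a|.
    by rewrite sumr_const card_ord mulr_natl.
  apply: ler_sum => i _; rewrite /th /hybrid; case: ifP => _; last by rewrite distrC.
  by rewrite subrr normr0.
have l1 := lip _ (fun c => F01 (j |: c)).
have l2 := lip _ (fun c => F01 (c :\ j)).
have l3 : `|bernE (fun=> a') (fun c => F (c :\ j)) - bernE (fun=> a') F| <= a'.
  rewrite [X in `|_ - X|](bernE_total _ j).
  have /andP[a0 a1] := bernE_itv01 (fun _ : 'I_n => ha') (fun c => F01 (j |: c)).
  have /andP[b0 b1] := bernE_itv01 (fun _ : 'I_n => ha') (fun c => F01 (c :\ j)).
  set x := bernE _ _ in a0 a1 *; set y := bernE _ _ in b0 b1 *.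
  have -> : y - (a' * x + (1 - a') * y) = a' * (y - x) by ring.
  rewrite normrM ger0_norm; last by lra.
  by rewrite -[leRHS]mulr1 ler_wpM2l ?ler_norml; lra.
move: l1 l2 l3; rewrite !ler_norml; lra.
Qed.

Lemma bernE_all_mem (b : R) (l : seq nat) : 0 <= b <= 1 -> uniq l ->
  bernE (fun=> b) (fun c => (all (mem (sites c)) l)%:R) <= b ^+ size l.
Proof.
move=> b01; elim: l => [_|i l IH /= /andP[il /IH{}IH]].
  by rewrite /= expr0 bernE_cst.
have [i_n|ni] := ltnP i n; last first.
  rewrite (_ : bernE _ _ = 0); last first.
    rewrite -[RHS](bernE_cst (fun=> b)); apply: eq_bernE => c.
    rewrite (_ : i \in sites c = false) //; apply/negbTE/negP => /sites_lt; lia.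
  by rewrite exprn_ge0 //; case/andP: b01.
pose j := Ordinal i_n.
have -> : bernE (fun=> b) (fun c => ((i \in sites c) && all (mem (sites c)) l)%:R) =
    bernE (fun=> b) (fun c => (j \in c)%:R * (all (mem (sites c)) l)%:R).
  by apply: eq_bernE => c; rewrite -[i]/(val j) mem_sites; case: (j \in c); rewrite /= ?mul1r ?mul0r.
rewrite bernE_mem exprS ler_wpM2l //; first by case/andP: b01.
apply: le_trans IH; apply: le_bernE => // c.
rewrite (eq_in_all (a2 := mem (sites c))) // => k kl /=.
apply/idP/idP => [kc|kc].
  have kn := sites_lt kc; move: kc; rewrite -[k]/(val (Ordinal kn)) !mem_sites !inE.
  by case/predU1P => // kj; move: il; rewrite -[i]/(val j) -kj kl.
have kn := sites_lt kc; move: kc; rewrite -[k]/(val (Ordinal kn)) !mem_sites !inE => ->.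
by rewrite orbT.
Qed.

End bernoulli_sums.

(** * The mean effect of halving the mesh *)

Lemma gain_perm L k u (s t : seq nat) : perm_eq s t -> gain L k u s = gain L k u t.
Proof.
move=> st; rewrite /gain (crowded_perm _ _ st) (permP st).
by rewrite (@crowded_perm _ (nearn L) k (u./2 :: s) (u./2 :: t)) // perm_cons.
Qed.

Lemma partner_gt L u : (0 < L)%N -> (u < partner L u)%N.
Proof. by rewrite /partner; case: ifP => _ L0; lia. Qed.

Lemma partner_inj L : (0 < L)%N -> injective (partner L).
Proof.
by move=> L0 u v; rewrite /partner; case: ifP => ou; case: ifP => ov; lia.
Qed.

Definition coarse n (e : {set 'I_(n.*2)}) : {set 'I_n} :=
  [set i : 'I_n | (i.*2 \in sites e) || (i.*2.+1 \in sites e)].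

Lemma half_ord_proof n (u : 'I_(n.*2)) : (u./2 < n)%N.
Proof. by have := ltn_ord u; lia. Qed.

Definition half_ord n (u : 'I_(n.*2)) : 'I_n := Ordinal (half_ord_proof u).

Lemma mem_sites_coarse n (e : {set 'I_(n.*2)}) : sites (coarse e) =i map half (sites e).
Proof.
move=> i; apply/idP/mapP => [/[dup] /sites_lt i_n|[u ue ->]].
  rewrite -[i in i \in _]/(val (Ordinal i_n)) mem_sites inE /= => /orP[h|h].
    by exists i.*2 => //; lia.
  by exists i.*2.+1 => //; lia.
have u_n := sites_lt ue; rewrite -[_./2]/(val (half_ord (Ordinal u_n))) mem_sites inE /=.
have [ou|ou] := boolP (odd u).
  by rewrite (_ : u./2.*2.+1 = u) ?ue ?orbT //; lia.
by rewrite (_ : u./2.*2 = u) ?ue //; lia.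
Qed.

Lemma coarse_setU1 n (u : 'I_(n.*2)) (e : {set 'I_(n.*2)}) :
  coarse (u |: e) = half_ord u |: coarse e.
Proof.
apply/setP => i; rewrite !inE.
have memU v : (v \in sites (u |: e)) = (v == val u) || (v \in sites e).
  apply/idP/orP => [vU|[/eqP ->|ve]].
  - have vn := sites_lt vU; move: vU; rewrite -[v]/(val (Ordinal vn)) !mem_sites !inE.
    by move=> /orP.
  - by rewrite mem_sites finset.setU11.
  - have vn := sites_lt ve; move: ve; rewrite -[v]/(val (Ordinal vn)) !mem_sites !inE.
    by move=> ->; rewrite orbT.
rewrite !memU -[i == _]val_eqE /= [LHS]orbACA.
by congr (_ || _); lia.
Qed.

Section refinement.
Variables (R : realFieldType) (n L k : nat).
Hypothesis L_gt0 : (0 < L)%N.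
Implicit Type (e : {set 'I_(n.*2)}).

Definition defect e : R := (crowded (nearn L.*2) k (sites e))%:R -
  (crowded (nearn L) k (sites (coarse e)))%:R.

Definition bad_gain (u : nat) e : bool :=
  bad_pair L (sites e) u && gain L k u (sites (coarse e)).

(** With b bad pairs this is b (b - 1). *)
Definition double_bad e : R :=
  \sum_(u < n.*2) \sum_(v < n.*2 | v != u)
    (bad_pair L (sites e) u && bad_pair L (sites e) v)%:R.

(** Without two distinct bad pairs both sides agree by [crowded_refine0],
    [crowded_refine_odd] and [crowded_refine_even].  With b >= 2 of them the left-hand
    side is at most 1 + b, and [double_bad] is b (b - 1). *)
Lemma defect_approx e :
  `|defect e - \sum_(u < n.*2) (bad_gain u e)%:R| <= 2 * double_bad e.
Proof.
have db0 : 0 <= double_bad e by do 2!apply: sumr_ge0 => ? _.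
have bad_lt u : bad_pair L (sites e) u -> (u < n.*2)%N by case/andP => /sites_lt.
have [/existsP[u bu]|/existsPn nb] := boolP [exists u : 'I_(n.*2), bad_pair L (sites e) u].
  have [/existsP[v /andP[vu bv]]|/existsPn nb] :=
      boolP [exists v : 'I_(n.*2), (v != u) && bad_pair L (sites e) v].
    pose B : R := \sum_(u < n.*2) (bad_pair L (sites e) u)%:R.
    have le1 : \sum_(u < n.*2) (bad_gain u e)%:R <= B.
      by apply: ler_sum => x _; rewrite ler_nat /bad_gain; case: bad_pair; rewrite ?leq_b1.
    have ge0 : 0 <= \sum_(u < n.*2) (bad_gain u e)%:R :> R by apply: sumr_ge0.
    have B1 : 1 <= B.
      by rewrite /B (bigD1 u) //= bu lerDl; apply: sumr_ge0.
    have le2 : B <= double_bad e.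
      apply: ler_sum => x _; case: (boolP (bad_pair _ _ x)) => bx; last exact: sumr_ge0.
      have [y yx by_] : exists2 y : 'I_(n.*2), y != x & bad_pair L (sites e) y.
        have [xu|xu] := eqVneq x u; first by exists v; rewrite // xu.
        by exists u => //; rewrite eq_sym.
      by rewrite (bigD1 y) //= by_ lerDl; apply: sumr_ge0.
    have d1 : `|defect e| <= 1.
      by rewrite /defect; case: crowded; case: crowded; rewrite /= ler_norml; lra.
    by move: d1; rewrite !ler_norml; lra.
  have nb' v : bad_pair L (sites e) v -> v = u :> nat.
    move=> bv; have := nb (Ordinal (bad_lt _ bv)); rewrite /= bv andbT.
    by rewrite negbK -val_eqE => /eqP.
  have -> : defect e = \sum_(u < n.*2) (bad_gain u e)%:R.
    rewrite (bigD1 u) //= big1 => [|v vu].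
      rewrite addr0 /defect /bad_gain bu /=.
      have -> : crowded (nearn L.*2) k (sites e) = crowded (nearn L) k (sites (coarse e))
          || gain L k u (sites (coarse e)).
        have [ou|ou] := boolP (odd u).
          by apply: crowded_refine_odd => //; exact/sites_uniq || exact: mem_sites_coarse.
        by apply: crowded_refine_even => //; exact/sites_uniq || exact: mem_sites_coarse.
      rewrite /gain; case: crowded => /=; first by rewrite subrr.
      by rewrite subr0.
    rewrite /bad_gain; case: (boolP (bad_pair _ _ v)) => // /nb' /val_inj vu'.
    by rewrite vu' eqxx in vu.
  by rewrite subrr normr0 mulr_ge0.
have -> : defect e = 0.
  rewrite /defect (@crowded_refine0 L k (sites e) (sites (coarse e))) ?subrr //.
  - exact: sites_uniq.
  - exact: sites_uniq.
  - exact: mem_sites_coarse.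
  move=> u; apply/negP => bu; have := nb (Ordinal (bad_lt _ bu)).
  by rewrite /= bu.
rewrite big1 ?subrr ?normr0 ?mulr_ge0 // => u _.
by rewrite /bad_gain; have /negbTE /= -> := nb u.
Qed.

Variable b : R.
Hypothesis b01 : 0 <= b <= 1.

(** Two distinct bad pairs occupy four sites, or three if one starts where the
    other ends; since [partner] is injective, at most 2 (2n) ordered pairs of bad
    pairs overlap. *)
Lemma bernE_double_bad : bernE (fun=> b) double_bad <=
  (n.*2%:R * b ^+ 2) ^+ 2 + 2 * n.*2%:R * b ^+ 3.
Proof.
have [b0 b1] := andP b01.
rewrite bernE_sum.
have bnd (u : 'I_(n.*2)) : bernE (fun=> b) (fun c : {set 'I_(n.*2)} => \sum_(v < n.*2 | v != u)
    (bad_pair L (sites c) u && bad_pair L (sites c) v)%:R) <=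
    \sum_(v < n.*2) (b ^+ 4 + ((val v == partner L u)%:R +
                               (val u == partner L v)%:R) * b ^+ 3).
  rewrite bernE_sum big_mkcond /=; apply: ler_sum => v _.
  have b3 : 0 <= b ^+ 3 by apply: exprn_ge0.
  have b4 : 0 <= b ^+ 4 by apply: exprn_ge0.
  case: ifP => [vu|_]; last by rewrite addr_ge0 // mulr_ge0 // addr_ge0.
  have main l r : uniq l -> b ^+ size l <= r ->
      (forall c : {set 'I_(n.*2)}, bad_pair L (sites c) u -> bad_pair L (sites c) v ->
         all (mem (sites c)) l) ->
      bernE (fun=> b) (fun c : {set 'I_(n.*2)} => (bad_pair L (sites c) u && bad_pair L (sites c) v)%:R) <= r.
    move=> lU lr lb; apply: le_trans _ lr; apply: le_trans _ (bernE_all_mem n.*2 b01 lU).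
    apply: le_bernE => // c; rewrite ler_nat.
    by have := lb c; do 2!case: bad_pair => //; move=> ->.
  have [vp|vp] := eqVneq (val v) (partner L u).
    apply: (main [:: val u; partner L u; partner L (partner L u)]) => /=.
    - have := partner_gt u L_gt0; have := partner_gt (partner L u) L_gt0.
      rewrite !inE; lia.
    - by have [] := eqVneq (val u) (partner L v); rewrite ?mulr1n ?mulr0n; lra.
    - by move=> c /andP[h1 h2] /andP[h3]; rewrite -vp h3 => ->; rewrite h1.
  have [up|up] := eqVneq (val u) (partner L v).
    apply: (main [:: val v; partner L v; partner L (partner L v)]) => /=.
    - have := partner_gt v L_gt0; have := partner_gt (partner L v) L_gt0.
      rewrite !inE; lia.
    - by rewrite ?mulr1n ?mulr0n; lra.
    - by move=> c /andP[h1 h2] /andP[h3 h4]; rewrite -up h1 h2 h3.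
  apply: (main [:: val u; partner L u; val v; partner L v]) => /=.
  - have := partner_gt v L_gt0; have := partner_gt u L_gt0.
    have : partner L u != partner L v.
      by rewrite (inj_eq (partner_inj L_gt0)) val_eqE eq_sym.
    have : val u != val v by rewrite val_eqE eq_sym.
    move: vp up; rewrite !inE /=; lia.
  - by rewrite ?mulr0n; lra.
  - by move=> c /andP[-> ->] /andP[-> ->].
apply: le_trans (ler_sum _ (fun u _ => bnd u)) _.
have le1 (P : pred nat) : (forall x y, P x -> P y -> x = y) ->
    \sum_(u < n.*2) (P u)%:R <= 1 :> R.
  move=> P1; case: (pickP (fun u : 'I_(n.*2) => P u)) => [u Pu|P0].
    rewrite (bigD1 u) //= Pu big1 ?addr0 // => v vu.
    by case: (boolP (P v)) => // /(P1 _ _ Pu) /val_inj uv; rewrite uv eqxx in vu.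
  by rewrite big1 // => u _; rewrite P0.
under eq_bigr do rewrite big_split /= sumr_const card_ord -mulr_suml big_split /=.
rewrite big_split /= sumr_const card_ord -mulr_suml big_split /= -!mulrnA.
have s1 : \sum_(u < n.*2) \sum_(v < n.*2) (val v == partner L u)%:R <= n.*2%:R :> R.
  rewrite -[leRHS]mulr1 mulr_natl -[X in _ *+ X]card_ord -sumr_const.
  by apply: ler_sum => u _; apply: (le1 (fun v => v == partner L u)) => x y /eqP -> /eqP ->.
have s2 : \sum_(u < n.*2) \sum_(v < n.*2) (val u == partner L v)%:R <= n.*2%:R :> R.
  rewrite -[leRHS]mulr1 mulr_natl -[X in _ *+ X]card_ord -sumr_const.
  apply: ler_sum => u _; apply: (le1 (fun v => val u == partner L v)) => x y /eqP ux /eqP uy.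
  by apply: (partner_inj L_gt0); rewrite -ux.
apply: lerD.
  by rewrite -[leLHS]mulr_natr natrM (_ : b ^+ 4 * _ = (n.*2%:R * b ^+ 2) ^+ 2) //; ring.
by apply: ler_wpM2r; [exact: exprn_ge0 | lra].
Qed.

Lemma bernE_mem2 m (u v : 'I_m) (F : {set 'I_m} -> R) : u != v ->
  bernE (fun=> b) (fun c => ((u \in c) && (v \in c))%:R * F c) =
  b ^+ 2 * bernE (fun=> b) (fun c => F (u |: (v |: c))).
Proof.
move=> uv; transitivity
    (bernE (fun=> b) (fun c : {set 'I_m} => (u \in c)%:R * ((v \in c)%:R * F c))).
  by apply: eq_bernE => c; rewrite mulrA -natrM mulnb.
rewrite (bernE_mem _ u (fun c => (v \in c)%:R * F c)) expr2 -mulrA; congr (_ * _).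
rewrite -(bernE_mem _ v (fun c => F (u |: c))); apply: eq_bernE => c.
by rewrite !inE [v == u]eq_sym (negbTE uv).
Qed.

Lemma bernE_bad_gain_even (i : 'I_n) :
  bernE (fun=> b) (fun e => (bad_gain i.*2 e)%:R) = b ^+ 2 *
  bernE (fun=> b) (fun e => (gain L k i.*2 (sites (i |: coarse e)))%:R).
Proof.
have lo_n : (i.*2 < n.*2)%N by have := ltn_ord i; lia.
have hi_n : (i.*2.+1 < n.*2)%N by have := ltn_ord i; lia.
pose u := Ordinal lo_n; pose v := Ordinal hi_n.
have uv : u != v by rewrite -val_eqE /=; lia.
have hu : half_ord u = i by apply: val_inj => /=; lia.
have hv : half_ord v = i by apply: val_inj => /=; lia.
have -> : bernE (fun=> b) (fun e => (gain L k i.*2 (sites (i |: coarse e)))%:R)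
  = bernE (fun=> b) (fun e => (gain L k i.*2 (sites (coarse (u |: (v |: e)))))%:R : R).
  by apply: eq_bernE => e; rewrite !coarse_setU1 hu hv finset.setUA finset.setUid.
rewrite -(bernE_mem2 (fun e => (gain L k i.*2 (sites (coarse e)))%:R) uv).
apply: eq_bernE => e; rewrite /bad_gain /bad_pair /partner odd_double.
have := mem_sites e u; have := mem_sites e v; rewrite /= => -> ->.
by rewrite -natrM mulnb.
Qed.

Lemma bernE_bad_gain_odd (i j : 'I_n) : j = (i + L)%N :> nat ->
  bernE (fun=> b) (fun e => (bad_gain i.*2.+1 e)%:R) = b ^+ 2 *
  bernE (fun=> b) (fun e => (gain L k i.*2.+1 (sites (i |: (j |: coarse e))))%:R).
Proof.
move=> jE.
have lo_n : (i.*2.+1 < n.*2)%N by have := ltn_ord i; lia.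
have hi_n : (j.*2 < n.*2)%N by have := ltn_ord j; lia.
pose u := Ordinal lo_n; pose v := Ordinal hi_n.
have uv : u != v by rewrite -val_eqE /=; lia.
have hu : half_ord u = i by apply: val_inj => /=; lia.
have hv : half_ord v = j by apply: val_inj => /=; lia.
have -> : bernE (fun=> b) (fun e => (gain L k i.*2.+1 (sites (i |: (j |: coarse e))))%:R)
  = bernE (fun=> b) (fun e => (gain L k i.*2.+1 (sites (coarse (u |: (v |: e)))))%:R : R).
  by apply: eq_bernE => e; rewrite !coarse_setU1 hu hv.
rewrite -(bernE_mem2 (fun e => (gain L k i.*2.+1 (sites (coarse e)))%:R) uv).
apply: eq_bernE => e; rewrite /bad_gain /bad_pair /partner /= odd_double /=.
have -> : (i.*2 + L.*2)%N = j.*2 by rewrite jE; lia.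
have := mem_sites e u; have := mem_sites e v; rewrite /= => -> ->.
by rewrite -natrM mulnb.
Qed.

(** Near the right end the partner of an odd site falls outside the grid. *)
Lemma bernE_bad_gain_out (i : 'I_n) : (n <= i + L)%N ->
  bernE (fun=> b) (fun e => (bad_gain i.*2.+1 e)%:R) = 0.
Proof.
move=> iL; rewrite -[RHS](bernE_cst (fun _ : 'I_(n.*2) => b)); apply: eq_bernE => e.
rewrite /bad_gain /bad_pair /partner /= odd_double /= (_ : _ + L.*2 \in _ = false)%N.
  by rewrite andbF.
by apply/negbTE/negP => /sites_lt; lia.
Qed.

Implicit Type (c : {set 'I_n}).

(** The gains of all occupied coarse sites.  The second summand asks what happens
    when the site at distance L from i is added to the configuration; it is the grid
    form of a summand of nu, as the first one is of nu_tilde. *)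
Definition total_gain (s : seq nat) : nat :=
  \sum_(i <- s) (gain L k i.*2 s +
                 ((i + L < n) && gain L k i.*2.+1 (undup (i + L :: s))))%N.

Lemma total_gain_perm (s t : seq nat) : perm_eq s t -> total_gain s = total_gain t.
Proof.
move=> st; rewrite /total_gain (perm_big _ st); apply: eq_bigr => i _.
rewrite (gain_perm _ _ _ st); congr (_ + (_ && _))%N; apply: gain_perm.
apply: uniq_perm => [||j]; [exact: undup_uniq | exact: undup_uniq |].
by rewrite !mem_undup !inE (perm_mem st).
Qed.

Lemma gain_setU1 u (j : 'I_n) (c : {set 'I_n}) :
  gain L k u (sites (j |: c)) = gain L k u (undup (val j :: sites c)).
Proof.
apply: gain_perm; apply: perm_sites; first exact: undup_uniq.
  move=> i; rewrite mem_undup inE => /predU1P[->|]; [exact: ltn_ord | exact: sites_lt].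
by move=> i; rewrite mem_undup !inE mem_sites val_eqE.
Qed.

(** The Mecke formula is used twice on the fine grid, to force both sites of the bad
    pair, and once backwards on the coarse grid, to read the forced site i as a site
    of the configuration.  The hypothesis says that halving maps the Bernoulli law of
    parameter b to that of parameter a. *)
Lemma bernE_sum_bad_gain (a : R) :
  (forall F : {set 'I_n} -> R,
    bernE (fun=> b) (fun e => F (coarse e)) = bernE (fun=> a) F) ->
  a * bernE (fun=> b) (fun e => \sum_(u < n.*2) (bad_gain u e)%:R) =
  b ^+ 2 * bernE (fun=> a) (fun c => (total_gain (sites c))%:R).
Proof.
move=> ab; rewrite bernE_sum.
have split2 (G : nat -> R) : \sum_(u < n.*2) G u = \sum_(i < n) (G i.*2 + G i.*2.+1).
  elim: n => [|m IH]; first by rewrite !big_ord0.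
  by rewrite doubleS !big_ord_recr /= IH addrA.
rewrite (split2 (fun u => bernE (fun=> b) (fun e => (bad_gain u e)%:R))) mulr_sumr.
have -> : bernE (fun=> a) (fun c => (total_gain (sites c))%:R) = bernE (fun=> a)
    (fun c => \sum_(i < n) (i \in c)%:R * ((gain L k i.*2 (sites c))%:R
  + ((i + L < n)%N && gain L k i.*2.+1 (undup ((i + L)%N :: sites c)))%:R)) :> R.
  apply: eq_bernE => c; rewrite /total_gain /sites big_map -/(sites c) big_enum /= natr_sum.
  rewrite big_mkcond /=; apply: eq_bigr => i _; rewrite natrD.
  by case: ifP; rewrite ?mul1r ?mul0r.
rewrite bernE_sum mulr_sumr; apply: eq_bigr => i _; rewrite bernE_mem.
rewrite bernE_bad_gain_even (ab (fun c => (gain L k i.*2 (sites (i |: c)))%:R)).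
have [iL|iL] := ltnP (i + L) n; last first.
  rewrite bernE_bad_gain_out // addr0 mulrCA; congr (_ * (_ * _)).
  by apply: eq_bernE => c; rewrite addr0.
pose j := Ordinal iL.
rewrite (@bernE_bad_gain_odd i j) //.
rewrite (ab (fun c => (gain L k i.*2.+1 (sites (i |: (j |: c))))%:R)).
rewrite -mulrDr mulrCA; congr (_ * (_ * _)).
by rewrite -bernED; apply: eq_bernE => c; rewrite finset.setUCA (gain_setU1 _ j).
Qed.


End refinement.

(** * Finite point configurations and their cells *)

Section cells.
Variable R : realType.
Implicit Types (x y w t : R) (s : seq R) (n L k : nat).

Definition nearr w : rel R := fun x y => x <= y < x + w.

(** Cells are the intervals ]i/n, (i+1)/n], closed on the right like the windows;
    hence the ceiling minus one. *)
Definition cell n x : nat := `|Num.ceil (n%:R * x)|%N.-1.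

Lemma cellP n x : (0 < n)%N -> 0 < x ->
  (cell n x)%:R < n%:R * x <= (cell n x).+1%:R.
Proof.
move=> n0 x0; have nx0 : 0 < n%:R * x by rewrite mulr_gt0 // ltr0n.
have c0 : (0 < Num.ceil (n%:R * x))%R by rewrite ceil_gt0.
(* The ceiling is positive, so passing through its absolute value and .-1 is exact. *)
have cE : (`|Num.ceil (n%:R * x)|%N : int) = Num.ceil (n%:R * x) by lia.
have c1 : (cell n x).+1%:R = (Num.ceil (n%:R * x))%:~R :> R.
  by rewrite -[RHS](congr1 intr cE) -pmulrn prednK //; lia.
rewrite c1; apply/andP; split; last exact: ceil_ge.
have := @ceilB1_lt R (n%:R * x).
by rewrite -[(cell n x)%:R](addrK 1) -natr1 in c1 *; rewrite intrD c1; lra.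
Qed.

Lemma cell_lt n x : (0 < n)%N -> 0 < x <= 1 -> (cell n x < n)%N.
Proof.
move=> n0 /andP[x0 x1]; have /andP[c _] := cellP n0 x0.
rewrite -(ltr_nat R); apply: lt_le_trans c _.
by rewrite -[leRHS]mulr1 ler_wpM2l.
Qed.

Lemma cell_uniq n x (i : nat) : (0 < n)%N -> 0 < x ->
  i%:R < n%:R * x <= i.+1%:R -> cell n x = i.
Proof.
move=> n0 x0 /andP[h1 h2]; have /andP[c1 c2] := cellP n0 x0.
have : ((cell n x)%:R : R) < i.+1%:R by lra.
have : (i%:R : R) < (cell n x).+1%:R by lra.
by rewrite !ltr_nat; lia.
Qed.

Lemma half_cell n x : (0 < n)%N -> 0 < x -> (cell n.*2 x)./2 = cell n x.
Proof.
move=> n0 x0; apply/esym/cell_uniq => //.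
have n20 : (0 < n.*2)%N by lia.
have /andP[] := cellP n20 x0.
rewrite (_ : n.*2%:R = n%:R * 2 :> R); last by rewrite -muln2 natrM.
have -> : cell n.*2 x = ((cell n.*2 x)./2 * 2 + odd (cell n.*2 x))%N by lia.
set c := (cell n.*2 x)./2; set o := odd _.
rewrite (_ : (c * 2 + o)./2 = c)%N; last by lia.
rewrite -!natr1 natrD natrM; case: o => /=; rewrite ?mulr1n ?mulr0n => h1 h2; lra.
Qed.

(** A shift by a whole number of cells moves indices exactly, and rounding moves
    each point by at most 1/n. *)
Lemma cell_lt_shift n (D : nat) x y d : (0 < n)%N -> 0 < x -> 0 < y ->
  n%:R * d = D%:R -> n%:R^-1 < `|y - x - d| ->
  (cell n y < cell n x + D)%N = (y < x + d).
Proof.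
move=> n0 x0 y0 nd far.
have /andP[a1 a2] := cellP n0 x0; have /andP[b1 b2] := cellP n0 y0.
have nR : 0 < n%:R :> R by rewrite ltr0n.
have far' : 1 < `|n%:R * y - n%:R * x - D%:R|.
  rewrite -nd -!mulrBr normrM ger0_norm ?ler0n //.
  by rewrite -[ltLHS](mulfV (lt0r_neq0 nR)) ltr_pM2l.
have yE : (y < x + d) = (n%:R * y < n%:R * x + D%:R).
  by rewrite -nd -mulrDr ltr_pM2l.
rewrite -(ltr_nat R) natrD yE; move: a2 b2; rewrite -!natr1 => a2 b2.
by apply/idP/idP; move: far'; case: (ler0P (n%:R * y - n%:R * x - D%:R)) => *; lra.
Qed.

Lemma cell_neq_shift n (D : nat) x y d : (0 < n)%N -> 0 < x -> 0 < y ->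
  n%:R * d = D%:R -> n%:R^-1 < `|y - x - d| -> cell n y != (cell n x + D)%N.
Proof.
move=> n0 x0 y0 nd far.
have /andP[a1 a2] := cellP n0 x0; have /andP[b1 b2] := cellP n0 y0.
have nR : 0 < n%:R :> R by rewrite ltr0n.
have far' : 1 < `|n%:R * y - n%:R * x - D%:R|.
  rewrite -nd -!mulrBr normrM ger0_norm ?ler0n //.
  by rewrite -[ltLHS](mulfV (lt0r_neq0 nR)) ltr_pM2l.
apply/eqP => cE; have : (cell n y)%:R = (cell n x)%:R + D%:R :> R by rewrite cE natrD.
move: a2 b2; rewrite -!natr1 => a2 b2.
by move: far'; case: (ler0P (n%:R * y - n%:R * x - D%:R)) => *; lra.
Qed.

(** The distance 2w is excluded because [gain] also compares points with the site
    added at distance w, whose own window ends at distance 2w. *)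
Definition generic w s : Prop :=
  [/\ uniq s, {in s, forall x, 0 < x <= 1} &
      {in s &, forall x y, y != x + w /\ y != x + (w + w)}].

(** The mesh 1/n is finer than every gap that genericity provides. *)
Definition resolves n w s : Prop := {in s &, forall x y,
  [/\ y != x -> n%:R^-1 < `|y - x - 0|,
      n%:R^-1 < `|y - x - w| & n%:R^-1 < `|y - x - (w + w)| ]}.

Lemma exists_inv_lt (l : seq R) : {in l, forall x, 0 < x} ->
  exists N : nat, forall n, (N <= n)%N -> {in l, forall x, n%:R^-1 < x}.
Proof.
elim: l => [|x l IH] lpos; first by exists 0%N.
have [N HN] := IH (fun y yl => lpos y (mem_behead (s := x :: l) yl)).
have x0 : 0 < x by apply: lpos; rewrite mem_head.
exists (maxn N (Num.bound x^-1)).+1 => n; rewrite gtn_max => /andP[Nn bn] y.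
rewrite inE => /predU1P[->|yl]; last by apply: HN => //; exact: ltnW.
have xV : 0 <= x^-1 by rewrite invr_ge0 ltW.
have n0 : 0 < n%:R :> R by rewrite ltr0n; exact: leq_ltn_trans bn.
rewrite -[x]invrK ltf_pV2 ?posrE ?invr_gt0 //.
by apply: lt_trans (archi_boundP xV) _; rewrite ltr_nat.
Qed.

Lemma generic_resolves w s : generic w s ->
  exists N : nat, forall n, (N <= n)%N -> resolves n w s.
Proof.
move=> [sU s01 sw].
pose l := [seq z <- flatten [seq [:: `|p.2 - p.1 - 0|; `|p.2 - p.1 - w|;
   `|p.2 - p.1 - (w + w)|] | p <- [seq (x, y) | x <- s, y <- s]] | 0 < z].
have [N HN] : exists N : nat, forall n, (N <= n)%N -> {in l, forall x, n%:R^-1 < x}.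
  by apply: exists_inv_lt => z; rewrite mem_filter => /andP[].
exists N => n /HN {}HN x y xs ys.
have inl z : 0 < z -> z \in [:: `|y - x - 0|; `|y - x - w|; `|y - x - (w + w)|] ->
    n%:R^-1 < z.
  move=> z0 zin; apply: HN; rewrite mem_filter z0; apply/flattenP.
  exists [:: `|y - x - 0|; `|y - x - w|; `|y - x - (w + w)|] => //.
  by apply/mapP; exists (x, y) => //; apply/allpairsP; exists (x, y).
have [yw yww] := sw _ _ xs ys.
split=> [yx||]; apply: inl; rewrite ?inE ?eqxx ?orbT //.
- by rewrite normr_gt0 subr0 subr_eq0.
- by rewrite normr_gt0 subr_eq0; apply: contra yw => /eqP <-; rewrite addrC subrK.
- by rewrite normr_gt0 subr_eq0; apply: contra yww => /eqP <-; rewrite addrC subrK.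
Qed.


Lemma scan_cons_le w s x : w <= 1 -> (scan w (x :: s) <= (scan w s).+1)%N.
Proof.
move=> w1; have [t tw <-] := scan_attained (x :: s) w1.
rewrite /in_window /num_points /= -add1n; apply: leq_add; first exact: leq_b1.
exact: in_window_le_scan.
Qed.

Lemma in_windowE w s t : in_window w s t = count (fun y => t < y <= t + w) s.
Proof.
by apply: eq_count => y /=; apply/asboolP/idP; rewrite /= in_itv.
Qed.

Lemma seq_minP s (P : pred R) : has P s ->
  exists x, [/\ x \in s, P x & {in s, forall y, P y -> x <= y}].
Proof.
elim: s => //= a s IH; have [hs _|/hasPn nh /orP[Pa|//]] := boolP (has P s).
  have [x [xs Px xmin]] := IH hs.
  have [/andP[Pa ax]|na] := boolP (P a && (a <= x)).
    exists a; split; rewrite ?mem_head // => y; rewrite inE => /predU1P[->//|ys] Py.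
    by apply: le_trans ax _; exact: xmin.
  exists x; split; rewrite ?inE ?xs ?orbT // => y; rewrite inE => /predU1P[->|ys] Py.
    by move: na; rewrite Py /= -ltNge => /ltW.
  exact: xmin.
exists a; split; rewrite ?mem_head // => y; rewrite inE => /predU1P[->//|/nh].
by move=> /negbTE ->.
Qed.

Lemma max_belowP s b : exists2 M, M < b & {in s, forall y, y < b -> y <= M}.
Proof.
elim: s => [|a s [M Mb IH]]; first by exists (b - 1); [lra|].
have [ab|ba] := ltP a b.
  exists (Num.max a M) => [|y]; first by rewrite gt_max ab.
  rewrite inE => /predU1P[->|ys] yb; rewrite le_max ?lexx //.
  by rewrite IH ?orbT.
exists M => // y; rewrite inE => /predU1P[->|]; [lra | exact: IH].
Qed.

(** Anchor the window at its smallest point. *)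
Lemma window_crowded w s k t : (0 < k)%N -> (k <= in_window w s t)%N ->
  exists x, [/\ x \in s, t < x <= t + w,
    {in s, forall y, t < y <= t + w -> x <= y} &
    (in_window w s t <= count (nearr w x) s)%N].
Proof.
move=> k0 kw; have /seq_minP[x [xs xw xmin]] : has (fun y => t < y <= t + w) s.
  by rewrite has_count -in_windowE; lia.
exists x; split=> //; rewrite in_windowE.
rewrite -!size_filter; apply: (@leq_trans (size [seq y <- [seq y <- s | t < y <= t + w] | nearr w x y])).
  rewrite (_ : [seq y <- [seq _ <- _ | _] | _] = [seq y <- s | t < y <= t + w]) //.
  apply/all_filterP/allP => y; rewrite mem_filter => /andP[yw ys].
  by rewrite /nearr xmin //=; lra.
by rewrite !size_filter count_filter; apply: sub_count => y /andP[].
Qed.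

(** This removes both the maximum over t and the restriction of t to [0, 1 - w]. *)
Lemma scan_crowded w s k : (0 < k)%N -> 0 < w <= 1 ->
  {in s, forall x, 0 < x <= 1} -> (k <= scan w s)%N = crowded (nearr w) k s.
Proof.
move=> k0 /andP[w0 w1] s01; apply/idP/hasP => [ks|[x xs kx]].
  have [t tw tE] := scan_attained s w1; rewrite -tE in ks.
  have [x [xs _ _ le]] := window_crowded k0 ks.
  by exists x => //; exact: leq_trans ks le.
(* The window that ends at the last point before x + w, moved right if it
   starts before 0, contains all points of [x, x + w[. *)
have [M Mb MP] := max_belowP s (x + w).
have /andP[x0 x1] := s01 _ xs.
have [M1 M1b M1P] : exists2 M1, M1 < x + w /\ M1 <= 1 &
    {in s, forall y, y < x + w -> y <= M1}.
  exists (Num.min M 1); first by split; rewrite ?gt_min ?Mb ?ge_min ?lexx ?orbT.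
  by move=> y ys yb; rewrite le_min MP //=; case/andP: (s01 _ ys).
have tw : 0 <= Num.max 0 (M1 - w) <= 1 - w.
  by rewrite le_max lexx /= ge_max; lra.
apply: leq_trans kx (leq_trans _ (in_window_le_scan s tw)).
rewrite in_windowE; apply: (@leq_trans (count (fun y => (y \in s) && nearr w x y) s)).
  by apply/eq_leq/eq_in_count => y ys; rewrite ys.
apply: sub_count => y /andP[ys /andP[xy yx]]; rewrite gt_max.
have := M1P _ ys yx; have : M1 - w <= Num.max 0 (M1 - w) by rewrite le_max lexx orbT.
lra.
Qed.
Section discretization.
Variables (n L : nat) (w : R) (s : seq R).
Hypotheses (n0 : (0 < n)%N) (nw : n%:R * w = L%:R) (sG : generic w s)
  (sR : resolves n w s).

Let s_gt0 x : x \in s -> 0 < x.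
Proof. by case: sG => _ s01 _ /s01 /andP[]. Qed.

Lemma cell_ltE : {in s &, forall x y, (cell n y < cell n x)%N = (y < x)}.
Proof.
move=> x y xs ys; have [->|yx] := eqVneq y x; first by rewrite ltnn ltxx.
have [/(_ yx) far _ _] := sR xs ys.
rewrite -[cell n x]addn0 (@cell_lt_shift n 0 x y 0) ?addr0 ?mulr0 //; exact: s_gt0.
Qed.

Lemma cell_ltDE : {in s &, forall x y, (cell n y < cell n x + L)%N = (y < x + w)}.
Proof.
move=> x y xs ys; have [_ far _] := sR xs ys.
by rewrite (@cell_lt_shift n L x y w) //; exact: s_gt0.
Qed.

Lemma cell_ltDDE : {in s &, forall x y,
  (cell n y < cell n x + (L + L))%N = (y < x + (w + w))}.
Proof.
move=> x y xs ys; have [_ _ far] := sR xs ys.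
rewrite (@cell_lt_shift n (L + L) x y (w + w)) //; try exact: s_gt0.
by rewrite mulrDr nw natrD.
Qed.

Lemma cell_inj : {in s &, injective (cell n)}.
Proof.
move=> x y xs ys xy; apply/eqP; have := cell_ltE xs ys; have := cell_ltE ys xs.
by rewrite xy ltnn; case: ltgtP.
Qed.

Lemma nearn_cell : {in s &, forall x y, nearn L (cell n x) (cell n y) = nearr w x y}.
Proof.
by move=> x y xs ys; rewrite /nearn /nearr cell_ltDE // leqNgt cell_ltE // -leNgt.
Qed.

Lemma cell_neqD : {in s &, forall x y, cell n y != (cell n x + L)%N}.
Proof.
move=> x y xs ys; have [_ far _] := sR xs ys.
by apply: (@cell_neq_shift n L x y w) => //; exact: s_gt0.
Qed.

Lemma map_cell_uniq : uniq (map (cell n) s).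
Proof. by case: sG => sU _ _; rewrite map_inj_in_uniq //; exact: cell_inj. Qed.

Lemma crowded_cells k : crowded (nearn L) k (map (cell n) s) = crowded (nearr w) k s.
Proof. exact/crowded_map/nearn_cell. Qed.

Lemma crowded_cells_cons k x : x \in s ->
  crowded (nearn L) k (cell n x :: map (cell n) s) = crowded (nearr w) k (x :: s).
Proof.
move=> xs; rewrite -map_cons; apply: crowded_map => y z ys zs; apply: nearn_cell.
  by move: ys; rewrite inE => /predU1P[->|].
by move: zs; rewrite inE => /predU1P[->|].
Qed.

Hypothesis w01 : 0 < w <= 1.
Let w0 : 0 < w. Proof. by case/andP: w01. Qed.
Let w1 : w <= 1. Proof. by case/andP: w01. Qed.
Let sU : uniq s. Proof. by case: sG. Qed.
Let s01 : {in s, forall x, 0 < x <= 1}. Proof. by case: sG. Qed.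

Variable k : nat.

Lemma gain_even Q : (0 < k)%N -> Q \in s ->
  gain L k (cell n Q).*2 (map (cell n) s) =
  (scan w s < k)%N && (scan w (Q :: s) == k).
Proof.
move=> k0 Qs; rewrite /gain odd_double doubleK crowded_cells crowded_cells_cons //.
rewrite -!scan_crowded //; last first.
  by move=> x; rewrite inE => /predU1P[->|]; exact: s01.
rewrite -ltnNge; apply: andb_id2l => sk; rewrite eqn_leq.
by rewrite (leq_trans (scan_cons_le s Q w1) sk).
Qed.

Let near_ext Q x := (((Q < x < Q + w)%R : nat) + count (nearr w x) s)%N.

(** Adding the site at distance L from the cell of Q adds one anchor, whose window
    covers [Q + w, Q + 2w[, and one more point to the windows anchored strictly
    between Q and Q + w. *)
Lemma gain_oddE Q : (0 < k)%N -> Q \in s ->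
  gain L k (cell n Q).*2.+1 (undup ((cell n Q + L)%N :: map (cell n) s)) =
  ~~ ((k <= (count (fun y => Q + w <= y < Q + (w + w))%R s).+1)%N ||
      has (fun x => (k <= near_ext Q x)%N) s) &&
  (k <= (in_window w s Q).+2)%N.
Proof.
move=> k0 Qs.
have Lc : (cell n Q + L)%N \notin map (cell n) s.
  by apply/mapP => -[x xs /esym/eqP]; apply/negP; exact: cell_neqD.
rewrite (undup_id (s := _ :: _)) /=; last by rewrite Lc map_cell_uniq.
have L0 : (0 < L)%N.
  by rewrite -(ltr_nat R) -nw mulr_gt0 // ltr0n.
rewrite /gain /= odd_double /= (_ : uphalf _ = cell n Q); last by lia.
congr (~~ _ && (k <= _)%N).
  have self a : nearn L a a by rewrite /nearn leqnn /=; lia.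
  rewrite /crowded /= self /= add1n.
  congr ((k <= _.+1)%N || _).
    rewrite count_map; apply: eq_in_count => y ys /=.
    rewrite /nearn leqNgt cell_ltDE // -leNgt -addnA cell_ltDDE //.
  rewrite has_map; apply: eq_in_has => x xs /=; congr (k <= _ + _)%N.
    rewrite /nearn ltn_add2r cell_ltE // andbC -(cell_ltDE Qs xs) ltn_neqAle.
    by rewrite cell_neqD.
  by rewrite count_map; apply: eq_in_count => y ys /=; exact: nearn_cell.
congr _.+1; rewrite /= {1}/nearn ltnn andbF add0n count_map in_windowE.
rewrite (eq_in_count (a2 := predU (pred1 Q) (fun y => Q < y <= Q + w))); last first.
  move=> y ys /=; rewrite /= nearn_cell // /nearr.
  have [yw _] : y != Q + w /\ y != Q + (w + w) by case: sG => _ _; apply.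
  have [->|yQ] := eqVneq y Q; first by rewrite lexx /= ltrDl.
  by rewrite /= le_eqVlt eq_sym (negbTE yQ) /= [in RHS]le_eqVlt (negbTE yw).
have := count_predUI (pred1 Q) (fun y => Q < y <= Q + w) s.
rewrite [in RHS]count_uniq_mem // Qs add1n => <-.
rewrite -[LHS]addn0; congr addn; apply/esym/eqP.
rewrite -leqn0 leqNgt -has_count; apply/hasPn => y _ /=.
by apply/negP => /andP[/eqP ->]; rewrite ltxx.
Qed.

(** For generic s the condition of nu on all t in [Q, Q + w] says that neither the
    windows anchored strictly between Q and Q + w nor the window starting at Q + w
    become crowded when a point is put just after Q + w. *)
Lemma gain_odd Q : (2 <= k)%N -> Q \in s ->
  gain L k (cell n Q).*2.+1 (undup ((cell n Q + L)%N :: map (cell n) s)) =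
  [&& (scan w s < k)%N, in_window w s Q == (k - 2)%N &
      `[< forall t : R, (Q <= t <= Q + w)%R -> (in_window w s t <= k - 2)%N >]].
Proof.
move=> k2 Qs; have k0 : (0 < k)%N by lia.
rewrite gain_oddE //; have w_gt0 : 0 < w := w0.
have ne x y : x \in s -> y \in s -> y != x + w /\ y != x + (w + w).
  by case: sG => _ _; apply.
apply/idP/idP.
  case/andP; rewrite negb_or -ltnNge => /andP[out /hasPn nx] kQ.
  have ns : (scan w s < k)%N.
    rewrite ltnNge scan_crowded //; apply/hasPn => x /nx.
    by rewrite /near_ext -!ltnNge; lia.
  have AQ : ((in_window w s Q).+1 <= count (nearr w Q) s)%N.
    rewrite in_windowE -[X in (X < _)%N]addn0 -addnS.
    have <- : count (pred1 Q) s = 1%N by rewrite count_uniq_mem // Qs.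
    rewrite -count_predUI addnC -[X in (_ <= X)%N]add0n leq_add //.
      rewrite leqn0 -leqn0 leqNgt -has_count; apply/hasPn => y _ /=.
      by apply/negP => /andP[] /[swap] /eqP ->; rewrite ltxx.
    rewrite -!size_filter; apply: uniq_leq_size; first exact: filter_uniq.
    move=> y; rewrite !mem_filter /nearr /= => /andP[+ ys]; rewrite ys andbT.
    have [yw _] := ne _ _ Qs ys.
    case/orP => [/andP[Qy]|/eqP ->]; last by rewrite lexx /= ltrDl.
    by rewrite le_eqVlt (negbTE yw) /= => ->; rewrite ltW.
  have := nx _ Qs; rewrite /near_ext ltxx /= add0n -ltnNge => kA.
  rewrite ns /=; apply/andP; split; first by lia.
  apply/asboolP => t tQ; rewrite leqNgt; apply/negP => tk.
  have t1 : (0 < in_window w s t)%N by lia.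
  have [x [xs xt xmin le]] := window_crowded t1 (leqnn _).
  have [xw _] := ne _ _ Qs xs.
  have [xQ|Qx] := ltP x (Q + w).
    by have := nx _ xs; rewrite /near_ext xQ (_ : Q < x) /=; [lia|lra].
  have {xw}Qx : Q + w < x by rewrite lt_neqAle eq_sym xw.
  suff : (in_window w s t <= count (fun y => Q + w <= y < Q + (w + w))%R s)%N by lia.
  rewrite in_windowE -!size_filter; apply: uniq_leq_size; first exact: filter_uniq.
  move=> y; rewrite !mem_filter => /andP[yt ys]; rewrite ys andbT.
  have [_ yww] := ne _ _ Qs ys; have xy := xmin _ ys yt.
  by rewrite lt_neqAle yww /=; lra.
case/and3P => ns /eqP QE /asboolP Qt; apply/andP; split; last by lia.
rewrite negb_or -ltnNge; apply/andP; split.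
  have tQ : Q <= Q + w <= Q + w by lra.
  have := Qt _ tQ; rewrite in_windowE => le.
  suff : (count (fun y => Q + w <= y < Q + (w + w))%R s <=
          count (fun y => Q + w < y <= Q + w + w)%R s)%N by move=> /leq_trans /(_ le); lia.
  rewrite -!size_filter; apply: uniq_leq_size; first exact: filter_uniq.
  move=> y; rewrite !mem_filter => /andP[yt ys]; rewrite ys andbT.
  have [yw _] := ne _ _ Qs ys; rewrite lt_neqAle eq_sym yw /=; lra.
apply/hasPn => x xs; rewrite -ltnNge /near_ext; have [/andP[Qx xQ]|_] := boolP (Q < x < Q + w).
  have [M Mb MP] := max_belowP s (x + w).
  have tQ : Q <= Num.max Q (M - w) <= Q + w.
    by rewrite le_max lexx /= ge_max; lra.
  have := Qt _ tQ; rewrite in_windowE => le.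
  suff : (count (nearr w x) s <=
     count (fun y => (Num.max Q (M - w) < y <= Num.max Q (M - w) + w)%R) s)%N
    by move=> /leq_trans /(_ le); lia.
  rewrite -!size_filter; apply: uniq_leq_size; first exact: filter_uniq.
  move=> y; rewrite !mem_filter => /andP[/andP[xy yx] ys]; rewrite ys andbT.
  have := MP _ ys yx; have : M - w <= Num.max Q (M - w) by rewrite le_max lexx orbT.
  by rewrite gt_max; lra.
move: ns; rewrite ltnNge scan_crowded // => /hasPn /(_ _ xs).
by rewrite -ltnNge.
Qed.

Lemma total_gain_cells : (2 <= k)%N -> {in s, forall x, x != 1 - w} ->
  total_gain n L k (map (cell n) s) = (nu w k s + nu_tilde w k s)%N.
Proof.
move=> k2 s1w; rewrite /total_gain big_map big_split [LHS]addnC; congr addn; last first.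
  by apply: eq_big_seq => Q Qs; rewrite gain_even //; lia.
rewrite /nu [RHS]big_mkcond; apply: eq_big_seq => Q Qs.
have -> : (cell n Q + L < n)%N = (Q < 1 - w).
  have /andP[c1 c2] := cellP n0 (s_gt0 Qs).
  have nR : 0 < n%:R :> R by rewrite ltr0n.
  have -> : (Q < 1 - w) = (n%:R * Q < n%:R - L%:R).
    by rewrite -(ltr_pM2l nR) mulrBr nw mulr1.
  apply/idP/idP => [h|h]; last by rewrite -(ltr_nat R) natrD; lra.
  have : n%:R * Q <= n%:R - L%:R.
    by move: h; rewrite -addSn -(ler_nat R) natrD; lra.
  rewrite le_eqVlt => /predU1P[E|//].
  have /eqP[] := s1w _ Qs.
  by apply: (mulfI (lt0r_neq0 nR)); rewrite E mulrBr nw mulr1.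
by case: ifP => _ //; rewrite gain_odd.
Qed.

End discretization.

End cells.

Lemma count_window_lt (L k a : nat) (s : seq nat) : (0 < k)%N ->
  ~~ crowded (nearn L) k s -> (count (fun y => a <= y < a + L) s < k)%N.
Proof.
move=> k0; rewrite ltnNge; apply: contra => ka.
have ex : exists y, (y \in s) && (a <= y < a + L)%N.
  have /hasP[y ys yw] : has (fun y => (a <= y < a + L)%N) s by rewrite has_count; lia.
  by exists y; rewrite ys.
have [x /andP[xs xw] xmin] := ex_minnP ex.
apply/hasP; exists x => //; apply: leq_trans ka _.
apply: (@leq_trans (count (fun y => (y \in s) && (a <= y < a + L)%N) s)).
  by apply/eq_leq/eq_in_count => y ys; rewrite ys.
apply: sub_count => y /[dup] /xmin xy /andP[_ yw]; rewrite /nearn; lia.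
Qed.

(** An uncrowded configuration has fewer than k points in each of q consecutive
    windows that cover the grid.  This bounds [total_gain] independently of m. *)
Lemma sparse_size (n m p q k : nat) (s : seq nat) : (0 < p)%N -> (0 < k)%N ->
  n = (m * q)%N -> {in s, forall i, i < n}%N ->
  ~~ crowded (nearn (m * p)) k s -> (size s <= q * k)%N.
Proof.
move=> p0 k0 nE sn ns.
have step j : (count (fun y => y < j * (m * p)) s <= j * k)%N.
  elim: j => [|j IH].
    by rewrite !mul0n leqn0 -leqn0 leqNgt -has_count; apply/hasPn.
  rewrite [(j.+1 * k)%N]mulSn addnC; apply: leq_trans (leq_add IH (ltnW (count_window_lt (j * (m * p)) k0 ns))).
  rewrite -count_predUI; apply: leq_trans _ (leq_addr _ _).
  by apply: sub_count => y /=; rewrite mulSn; lia.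
apply: leq_trans (step q); rewrite -[X in (X <= _)%N](count_predT s); apply/eq_leq.
apply: eq_in_count => y ys /=; apply/esym; have := sn _ ys; rewrite nE; nia.
Qed.

Lemma total_gain_le (n m p q k : nat) (s : seq nat) : (0 < p)%N -> (0 < k)%N ->
  n = (m * q)%N -> uniq s -> {in s, forall i, i < n}%N ->
  (total_gain n (m * p) k s <= 2 * (q * k))%N.
Proof.
move=> p0 k0 nE sU sn; rewrite /total_gain.
have [cs|cs] := boolP (crowded (nearn (m * p)) k s).
  rewrite big1_seq // => i _; rewrite /gain cs /=.
  suff -> : crowded (nearn (m * p)) k (undup ((i + m * p)%N :: s)) by rewrite andbF.
  by rewrite /=; case: ifP => _; rewrite undup_id //; exact: crowded_cons.
apply: leq_trans (leq_mul (leqnn 2) (sparse_size p0 k0 nE sn cs)).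
rewrite -[X in (_ <= _ * X)%N]sum1_size big_distrr /=; apply: leq_sum => i _.
exact: leq_add (leq_b1 _) (leq_b1 _).
Qed.

(** The count in ]t, t + w] is continuous from the right in t, and 1 - w is a grid
    point; hence countably many windows suffice, which makes scan events
    measurable. *)
Lemma scan_grid (R : realType) (p q k : nat) (w : R) (s : seq R) :
  (0 < q)%N -> (p <= q)%N -> w = p%:R / q%:R ->
  (k <= scan w s)%N <-> exists m i : nat, [/\ (0 < m)%N, (i <= m * (q - p))%N &
    (k <= in_window w s (i%:R / (m * q)%:R))%N].
Proof.
move=> q0 pq wE.
have qR : 0 < q%:R :> R by rewrite ltr0n.
have w1 : w <= 1 by rewrite wE ler_pdivrMr ?mul1r ?ler_nat.
split=> [|[m [i [m0 im /leq_trans]]]]; last first.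
  apply; apply: in_window_le_scan.
  have nR : 0 < (m * q)%:R :> R by rewrite ltr0n muln_gt0 m0.
  rewrite divr_ge0 //= ler_pdivrMr //.
  have -> : (1 - w) * (m * q)%:R = (m * (q - p))%:R.
    by rewrite wE !natrM natrB //; field; rewrite lt0r_neq0.
  by rewrite ler_nat.
have [t /andP[t0 tw] <- kt] := scan_attained s w1.
have [N HN] : exists N : nat, forall n, (N <= n)%N ->
    {in [seq y - t | y <- s & t < y], forall x : R, n%:R^-1 < x}.
  by apply: exists_inv_lt => z /mapP[y]; rewrite mem_filter => /andP[ty _] ->; rewrite subr_gt0.
(* Move t right to the next point c / n of a grid that is finer than the gaps
   between t and the points after it. *)
pose n := (N.+1 * q)%N; pose c := `|Num.ceil (n%:R * t)|%N.
have n0 : (0 < n)%N by rewrite /n muln_gt0.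
have nR : 0 < n%:R :> R by rewrite ltr0n.
have cge : 0 <= Num.ceil (n%:R * t).
  by rewrite ceil_ge0; apply: lt_le_trans (_ : 0 <= _); rewrite ?mulr_ge0 ?ler0n.
have cE : c%:R = (Num.ceil (n%:R * t))%:~R :> R by rewrite natr_absz ger0_norm.
exists N.+1, c; split=> //.
  have : (Num.ceil (n%:R * t) <= (N.+1 * (q - p))%N :> int).
    rewrite ceil_le_int; apply: le_trans (ler_wpM2l (ler0n _ _) tw) _.
    rewrite -pmulrn /n wE !natrM natrB // le_eqVlt; apply/orP; left.
    by apply/eqP; field; rewrite lt0r_neq0.
  by rewrite /c; lia.
apply: leq_trans kt _; rewrite !in_windowE -/n.
have ct : t <= c%:R / n%:R < t + (n%:R : R)^-1.
  rewrite ler_pdivlMr // mulrC cE ceil_ge /=.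
 rewrite ltr_pdivrMr // mulrDl mulVf ?lt0r_neq0 //.
  by have := ceilB1_lt (n%:R * t); rewrite intrB mulr1z; lra.
apply: (@leq_trans (count (fun y => (y \in s) && (t < y <= t + w)) s)).
  by apply/eq_leq/eq_in_count => y ys; rewrite ys.
apply: sub_count => y /andP[ys /andP[ty yw]].
have : (n%:R : R)^-1 < y - t.
  apply: HN; first by rewrite /n; nia.
  by apply/mapP; exists y; rewrite // mem_filter ty.
by move: ct ty yw; move: (c%:R / n%:R : R) ((n%:R : R)^-1) => z e; lra.
Qed.

(** * Integrals of finitely valued and of almost surely convergent functions *)

Section integration.
Context d (T : measurableType d) (R : realType).
Variable P : probability T R.
Import HBNNSimple.

(** This holds without measurability of f, because the integral of a nonnegative
    function is a supremum over the simple functions below it.  It spares a proof that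
    nu and nu_tilde are measurable functions of the configuration. *)
Lemma integral_off_negligible (f : T -> R) (N : set T) :
  measurable N -> P N = 0%E -> (forall x, 0 <= f x) ->
  (\int[P]_x (f x)%:E = \int[P]_x (f x * \1_(~` N) x)%:E)%E.
Proof.
move=> mN PN f0; have mCN : measurable (~` N) by exact: measurableC.
have f1 x : 0 <= f x * \1_(~` N) x by rewrite mulr_ge0 // indicE.
have f1f x : f x * \1_(~` N) x <= f x.
  by rewrite indicE; case: (_ \in _); rewrite /= ?mulr1 ?mulr0.
rewrite !ge0_integralTE; [|by move=> x; rewrite lee_fin..].
apply/eqP; rewrite eq_le; apply/andP; split; last first.
  apply: le_ereal_sup => _ [h hf1 <-]; exists h => // x.
  by apply: le_trans (hf1 x) _; rewrite lee_fin.
apply: ge_ereal_sup => _ [h hf <-].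
have -> : sintegral P h = sintegral P (proj_nnsfun h mCN).
  rewrite -!integralT_nnsfun; apply: ae_eq_integral => //.
  - by apply/measurable_EFinP.
  - by apply/measurable_EFinP.
  - exists N; split=> // x; apply: contraPP => Nx; apply => _ /=.
    by rewrite /proj_nnsfun /= mindicE mem_set // mulr1.
apply: ereal_sup_ubound; exists (proj_nnsfun h mCN) => // x.
have := hf x; rewrite !lee_fin /proj_nnsfun /= => hfx.
by rewrite ler_wpM2r // indicE.
Qed.

(** Dominated convergence to a limit that is only known to agree almost everywhere
    with a measurable function. *)
Lemma bounded_cvg_off_negligible (f_ : nat -> T -> R) (f : T -> R) (C : R) (N : set T) :
  (forall n, measurable_fun setT (f_ n)) -> (forall n x, 0 <= f_ n x <= C) ->
  (forall x, 0 <= f x) -> P.-negligible N ->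
  (forall x, ~ N x -> \forall n \near \oo, f_ n x = f x) ->
  (fun n => \int[P]_x (f_ n x)%:E)%E @ \oo --> (\int[P]_x (f x)%:E)%E.
Proof.
move=> mf_ f_C f0 [N' [mN' PN' NN']] f_f; rewrite (integral_off_negligible mN' PN' f0).
set g := fun x => f x * \1_(~` N') x.
have mi : measurable_fun setT (\1_(~` N') : T -> R).
  by apply: measurable_indic; exact: measurableC.
have cvg_off x : ~ N' x -> f_ ^~ x @ \oo --> f x.
  move=> N'x; apply: cvg_near_cst; apply: f_f; exact: contra_not (@NN' x) N'x.
have mg : measurable_fun setT g.
  apply: (@measurable_fun_cvg _ _ _ _ (fun n x => f_ n x * \1_(~` N') x)) => [n|x _].
    exact: measurable_funM.
  rewrite /g indicE; case: (boolP (x \in _)) => xN; last first.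
    by under eq_fun do rewrite mulr0; rewrite mulr0; exact: cvg_cst.
  under eq_fun do rewrite mulr1; rewrite mulr1.
  by apply: cvg_off; exact: (set_mem xN).
have [] := @dominated_convergence _ _ _ P setT measurableT
  (fun n x => (f_ n x)%:E) (fun x => (g x)%:E) (cst C%:E) => //.
- by move=> n; apply/measurable_EFinP.
- by apply/measurable_EFinP.
- exists N'; split=> // x; apply: contraPP => N'x; apply => _.
  rewrite /g indicE mem_set // mulr1; apply: cvg_EFin; first exact: nearW.
  exact: cvg_off.
- by apply: finite_measure_integrable_cst.
- by apply: aeW => x n _; have /andP[h0 h1] := f_C n x; rewrite lee_fin ger0_norm.
Qed.

Section finite_valued.
Variables (I : finType) (X : T -> I).
Hypothesis mX : forall c, measurable (X @^-1` [set c]).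

Lemma measurable_finite_valued (F : I -> R) : measurable_fun setT (F \o X).
Proof.
move=> _ Y mY; rewrite setTI.
rewrite (_ : _ @^-1` _ = \bigcup_(c in [set c | Y (F c)]) X @^-1` [set c]).
  by apply: fin_bigcup_measurable => //; exact: finite_finset.
apply/seteqP; split => [x Yx|x [c /= Yc Xx]]; first by exists (X x).
by rewrite /= Xx.
Qed.

Lemma integral_finite_valued (w : I -> R) (F : I -> R) :
  (forall c, P (X @^-1` [set c]) = (w c)%:E) -> (forall c, 0 <= F c) ->
  (\int[P]_x (F (X x))%:E = (\sum_c w c * F c)%:E)%E.
Proof.
move=> Pw F0.
have FE x : (F (X x))%:E = (\sum_(c <- enum I) (F c * \1_(X @^-1` [set c]) x)%:E)%E.
  rewrite sumEFin big_enum /= (bigD1 (X x)) //= indicE mem_set // mulr1.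
  rewrite big1 ?addr0 // => c cX; rewrite indicE memNset ?mulr0 //=.
  by move=> /esym/eqP; apply/negP.
under eq_integral do rewrite FE.
rewrite ge0_integral_sum //.
- rewrite big_enum /= -sumEFin; apply: eq_bigr => c _.
  under eq_integral do rewrite EFinM.
  rewrite ge0_integralZl //; last 2 first.
  + by apply/measurable_EFinP; exact: measurable_indic.
  + by rewrite lee_fin.
  by rewrite integral_indic // setIT [X in (_ * X)%E](Pw c) -EFinM mulrC.
- move=> c; apply/measurable_EFinP; exact: measurable_funM.
- by move=> c x _; rewrite lee_fin mulr_ge0 // indicE.
Qed.

End finite_valued.
End integration.

(** * The cells occupied by a Poisson process *)

Section process.
Context d (T : measurableType d) (R : realType).
Variables (P : probability T R) (lambda : R) (Pi : T -> seq R).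
Hypothesis hPi : poisson_process P lambda Pi.

Definition gcell (n i : nat) : set R := `](i%:R / n%:R), (i.+1%:R / n%:R)].

Definition occ (n : nat) (x : T) : {set 'I_n} :=
  [set i : 'I_n | (0 < num_points (gcell n i) (Pi x))%N].

Definition occ_prob (n : nat) : R := 1 - expR (- (lambda / n%:R)).

Lemma measurable_points (B : set R) (U : set nat) : measurable B ->
  measurable [set x | U (num_points B (Pi x))].
Proof.
move=> mB; have := pp_measurable hPi mB measurableT (Y := U).
by rewrite setTI; apply.
Qed.

Lemma Pi_gt0 x y : y \in Pi x -> 0 < y <= 1.
Proof. exact: (pp_support hPi). Qed.

Lemma measurable_gcell n i : measurable (gcell n i).
Proof. exact: measurable_itv. Qed.

Lemma gcellP n y (i : nat) : (0 < n)%N -> 0 < y -> gcell n i y <-> cell n y = i.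
Proof.
move=> n0 y0; have nR : 0 < n%:R :> R by rewrite ltr0n.
rewrite /gcell /= in_itv /= ltr_pdivrMr // ler_pdivlMr // [y * _]mulrC.
by split=> [|<-]; [exact: cell_uniq | exact: cellP].
Qed.

Lemma gcell_sub n (i : 'I_n) : gcell n i `<=` `]0, 1].
Proof.
have nR : 0 < n%:R :> R by rewrite ltr0n (leq_ltn_trans _ (ltn_ord i)).
move=> y; rewrite /gcell /= !in_itv /= => /andP[h1 h2]; apply/andP; split.
  by apply: le_lt_trans h1; rewrite divr_ge0.
by apply: le_trans h2 _; rewrite ler_pdivrMr // mul1r ler_nat.
Qed.

Lemma gcell_trivIset n : trivIset setT (fun i : 'I_n => gcell n i).
Proof.
apply/trivIsetP => i j _ _ ij; apply/eqP/negPn/negP => /set0P[y [yi yj]].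
have n0 : (0 < n)%N := leq_ltn_trans (leq0n i) (ltn_ord i).
have y0 : 0 < y by have := gcell_sub yi; rewrite /= in_itv /= => /andP[].
have /(gcellP _ n0 y0) ci := yi; have /(gcellP _ n0 y0) cj := yj.
by move/eqP: ij; apply; apply: val_inj; rewrite /= -ci -cj.
Qed.

Lemma lebesgue_gcell n i : (0 < n)%N -> lebesgue_measure (gcell n i) = (n%:R^-1)%:E.
Proof.
move=> n0; have nR : 0 < n%:R :> R by rewrite ltr0n.
rewrite /gcell lebesgue_measure_itv /= lte_fin ltr_pM2r ?invr_gt0 // ltr_nat ltnSn.
by rewrite -EFinD -mulrBl -natrB // subSnn mul1r.
Qed.

Lemma poisson_prob0 (r : R) : 0 < r -> poisson_prob r 0 [set 0%N] = (expR (- r))%:E.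
Proof.
by move=> r0; rewrite /poisson_prob r0 esum_set1 /poisson_pmf r0 ?expr0 ?mul1r ?fact0 ?invr1 ?mul1r ?lee_fin ?expR_ge0.
Qed.

Lemma points_prob n i : (i < n)%N -> forall U : set nat,
  P [set x | U (num_points (gcell n i) (Pi x))] = poisson_prob (lambda / n%:R) 0 U.
Proof.
move=> i_n U; have n0 : (0 < n)%N by lia.
by rewrite (pp_poisson hPi (measurable_gcell n i) (gcell_sub (i := Ordinal i_n))) lebesgue_gcell.
Qed.

Lemma mem_sites_occ n x : (0 < n)%N -> sites (occ n x) =i map (cell n) (Pi x).
Proof.
move=> n0 i; apply/idP/mapP => [/[dup] /sites_lt i_n|[y ys ->]].
  rewrite -[i in i \in _]/(val (Ordinal i_n)) mem_sites inE -has_count.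
  case/hasP => y ys /asboolP yi; exists y => //; have /andP[y0 _] := Pi_gt0 ys.
  by apply/esym/(gcellP _ n0 y0).
have i_n := cell_lt n0 (Pi_gt0 ys).
rewrite -[cell n y]/(val (Ordinal i_n)) mem_sites inE -has_count.
apply/hasP; exists y => //; apply/asboolP; have /andP[y0 _] := Pi_gt0 ys.
exact/(gcellP _ n0 y0).
Qed.

(** The occupied cells of the coarse grid are a function of those of the fine grid,
    so both grids can be compared on the same points. *)
Lemma coarse_occ n x : (0 < n)%N -> coarse (occ n.*2 x) = occ n x.
Proof.
move=> n0; apply/setP => i; rewrite -!mem_sites mem_sites_coarse mem_sites_occ //.
have -> : (val i \in map half (sites (occ n.*2 x))) =
    (val i \in map half (map (cell n.*2) (Pi x))).
  by apply/mapP/mapP => -[j js ->]; exists j => //; move: js; rewrite mem_sites_occ //; lia.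
rewrite -map_comp; congr (_ \in _); apply/eq_in_map => y ys /=.
by apply: half_cell => //; case/andP: (Pi_gt0 ys).
Qed.

Hypothesis lambda_gt0 : 0 < lambda.

Lemma rate_gt0 n : (0 < n)%N -> 0 < lambda / n%:R.
Proof. by move=> n0; rewrite divr_gt0 // ltr0n. Qed.

Lemma occ_fiber n (c : {set 'I_n}) : occ n @^-1` [set c] = \bigcap_(i in [set: 'I_n])
  ((fun x => num_points (gcell n i) (Pi x)) @^-1`
     [set j : nat | (i \in c) = (0 < j)%N]).
Proof.
apply/seteqP; split => [x <- i _ /=|x h]; first by rewrite inE.
by apply/setP => i; rewrite inE; apply/esym/h.
Qed.

Lemma measurable_occ n (c : {set 'I_n}) : measurable (occ n @^-1` [set c]).
Proof.
rewrite occ_fiber; apply: fin_bigcap_measurable; first exact: finite_finset.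
by move=> i _; apply: measurable_points; exact: measurable_gcell.
Qed.

Lemma occ_law n (c : {set 'I_n}) :
  P (occ n @^-1` [set c]) = (bernw (fun=> occ_prob n) c)%:E.
Proof.
rewrite occ_fiber.
rewrite (pp_independent hPi (fun i => measurable_gcell n i)
  (fun i => gcell_sub (i := i)) (gcell_trivIset (n := n))) //.
rewrite /bernw -prodEFin; apply: eq_bigr => i _.
have i_n := ltn_ord i; have r0 : 0 < lambda / n%:R by apply: rate_gt0; lia.
rewrite (points_prob i_n [set j : nat | (i \in c) = (0 < j)%N]).
case: (boolP (i \in c)) => ic; last first.
  rewrite (_ : [set _ | _] = [set 0%N]) ?poisson_prob0 // /occ_prob ?subKr //.
  by apply/seteqP; split => [[|j]|j ->] //=.
rewrite (_ : [set _ | _] = ~` [set 0%N]); last first.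
  by apply/seteqP; split => [[|j]|[|j]] //=.
by rewrite probability_setC // [X in (_ - X)%E](poisson_prob0 r0).
Qed.

(** From here on expectations over grid configurations are finite sums. *)
Lemma occ_integral n (F : {set 'I_n} -> R) : (forall c, 0 <= F c) ->
  (\int[P]_x (F (occ n x))%:E = (bernE (fun=> occ_prob n) F)%:E)%E.
Proof.
move=> F0; apply: (integral_finite_valued _ _ F0); first exact: measurable_occ.
exact: occ_law.
Qed.

End process.

(** * Null sets of configurations *)

Section almost_sure.
Context d (T : measurableType d) (R : realType).
Variables (P : probability T R) (lambda : R) (Pi : T -> seq R).
Hypotheses (lambda_gt0 : 0 < lambda) (hPi : poisson_process P lambda Pi).

Lemma occ_prob_le n : occ_prob lambda n <= lambda / n%:R.
Proof. by rewrite /occ_prob; have := expR_ge1Dx (- (lambda / n%:R)); lra. Qed.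

Lemma occ_prob01 n : 0 <= occ_prob lambda n <= 1.
Proof.
have r0 : 0 <= lambda / n%:R by rewrite divr_ge0 // ltW.
have e1 : expR (- (lambda / n%:R)) <= 1 by rewrite expR_le1 oppr_le0.
have e0 := expR_gt0 (- (lambda / n%:R)).
by rewrite /occ_prob; lra.
Qed.

Lemma measurable_occ_event n (F : pred {set 'I_n}) : measurable [set x | F (occ Pi n x)].
Proof.
rewrite (_ : [set _ | _] = \bigcup_(c in [set c | F c]) occ Pi n @^-1` [set c]).
  apply: fin_bigcup_measurable; first exact: finite_finset.
  by move=> c _; exact: (measurable_occ hPi).
apply/seteqP; split => [x Fx|x [c /= Fc xc]]; first by exists (occ Pi n x).
by rewrite /= xc.
Qed.

Lemma prob_integral (A : set T) : measurable A ->
  P A = (\int[P]_x (`[< A x >]%:R)%:E)%E.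
Proof.
move=> mA; rewrite -[A in LHS]setIT -(integral_indic _ measurableT mA).
by apply: eq_integral => x _; rewrite indicE; congr (_%:R%:E); apply/idP/asboolP;
  rewrite inE.
Qed.

Lemma occ_event_prob n (F : pred {set 'I_n}) :
  P [set x | F (occ Pi n x)] = (bernE (fun=> occ_prob lambda n) (fun c => (F c)%:R))%:E.
Proof.
rewrite -(occ_integral hPi lambda_gt0 (F := fun c => (F c)%:R)) //.
rewrite prob_integral; last exact: measurable_occ_event.
by apply: eq_integral => x _; rewrite /= asboolb.
Qed.

Lemma negligible_vanish (A : set T) (E : nat -> set T) (C : R) :
  (forall m, measurable (E m)) -> (forall m, A `<=` E m) ->
  (forall m, P (E m) <= (C / m.+1%:R)%:E)%E -> P.-negligible A.
Proof.
move=> mE AE PE; exists (\bigcap_m E m); split.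
- exact: bigcapT_measurable.
- have mI : measurable (\bigcap_m E m) by exact: bigcapT_measurable.
  have le m : (P (\bigcap_m E m) <= (C / m.+1%:R)%:E)%E.
    apply: le_trans (PE m); apply: le_measure; rewrite ?inE //.
    exact: bigcap_inf.
  apply/eqP; rewrite eq_le measure_ge0 andbT.
  have cv : (fun m : nat => (C / m.+1%:R)%:E) @ \oo --> (0 : R)%:E.
    apply: cvg_EFin; first exact: nearW.
    by rewrite -[0](mulr0 C); apply: cvgM; [exact: cvg_cst | exact: cvg_harmonic].
  rewrite -[leRHS](cvg_lim _ cv) //; apply: lime_ge; first by apply/cvg_ex; exists 0%E.
  exact: nearW.
- by move=> x Ax m _; exact: AE.
Qed.

(** On a grid whose mesh divides a, two points that differ by a occupy two cells whose
    indices differ by exactly a times n.  There are at most n such pairs of cells, each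
    occupied with probability at most (lambda / n)^2. *)
Lemma negligible_shift (q D : nat) (a : R) : (0 < q)%N -> (0 < D)%N -> a = D%:R / q%:R ->
  P.-negligible [set x | exists y z, [/\ y \in Pi x, z \in Pi x & z = y + a]].
Proof.
move=> q0 D0 aE.
pose F m (c : {set 'I_(m.+1 * q)}) :=
  [exists i : 'I_(m.+1 * q), all (mem (sites c)) [:: val i; (i + m.+1 * D)%N]].
apply: (@negligible_vanish _ (fun m => [set x | F m (occ Pi (m.+1 * q)%N x)]) (lambda ^+ 2)).
- by move=> m; exact: measurable_occ_event.
- move=> m x [y [z [ys zs zE]]] /=; pose n := (m.+1 * q)%N.
  have n0 : (0 < n)%N by rewrite /n muln_gt0.
  have /andP[y0 _] := Pi_gt0 hPi ys; have /andP[z0 _] := Pi_gt0 hPi zs.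
  have cz : cell n z = (cell n y + m.+1 * D)%N.
    apply: cell_uniq => //; have /andP[h1 h2] := cellP n0 y0.
    have -> : n%:R * z = n%:R * y + (m.+1 * D)%N%:R.
      by rewrite zE mulrDr aE /n !natrM; congr (_ + _); field; rewrite pnatr_eq0; lia.
    by move: (m.+1 * D)%N => e; rewrite -addSn (natrD _ (cell n y)) (natrD _ (cell n y).+1); lra.
  have i_n := cell_lt n0 (Pi_gt0 hPi ys).
  apply/existsP; exists (Ordinal i_n) => /=; rewrite -cz.
  by rewrite !(mem_sites_occ hPi) // !map_f.
- move=> m; rewrite occ_event_prob lee_fin; set n := (m.+1 * q)%N.
  have n0 : (0 < n)%N by rewrite /n muln_gt0.
  have nR : 0 < n%:R :> R by rewrite ltr0n.
  apply: (@le_trans _ _ (bernE (fun=> occ_prob lambda n) (fun c : {set 'I_n} => \sum_(i < n)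
      (all (mem (sites c)) [:: val i; (i + m.+1 * D)%N])%:R))).
    apply: le_bernE => [_|c]; first exact: occ_prob01.
    case: (boolP (F m c)) => [/existsP[i Fi]|_]; last exact: sumr_ge0.
    by rewrite (bigD1 i) //=; move: Fi => /= ->; rewrite lerDl; exact: sumr_ge0.
  rewrite bernE_sum.
  apply: (@le_trans _ _ (\sum_(i < n) (lambda / n%:R) ^+ 2)).
    apply: ler_sum => i _; apply: le_trans (bernE_all_mem n (occ_prob01 n) _) _.
      by rewrite /= inE; lia.
    have /andP[ge0 _] := occ_prob01 n; have l0 := le_trans ge0 (occ_prob_le n).
    by rewrite /= ler_pXn2r ?nnegrE // occ_prob_le.
  rewrite sumr_const card_ord -[leLHS]mulr_natl.
  have -> : n%:R * (lambda / n%:R) ^+ 2 = lambda ^+ 2 / n%:R.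
    by field; rewrite lt0r_neq0.
  rewrite ler_wpM2l ?exprn_ge0 ?(ltW lambda_gt0) // lef_pV2 ?posrE ?ltr0n // ler_nat.
  by rewrite /n leq_pmulr.
Qed.

Lemma poisson_prob_ge2 (r : R) : 0 < r ->
  (poisson_prob r 0 [set j | (1 < j)%N] <= (r ^+ 2)%:E)%E.
Proof.
move=> r0.
have -> : [set j | (1 < j)%N] = ~` ([set 0%N] `|` [set 1%N]).
  apply/seteqP; split => [[|[|j]] //= _ []//|[|[|j]] //= h].
    by exfalso; apply: h; left.
  by exfalso; apply: h; right.
rewrite probability_setC // measureU //; last by apply/seteqP; split => x //= [->].
have p1 : poisson_prob r 0 [set 1%N] = (r * expR (- r))%:E.
  by rewrite /poisson_prob r0 esum_set1 /poisson_pmf r0 ?expr1 ?factS ?fact0 ?invr1 ?mulr1 // lee_fin mulr_ge0 ?expR_ge0 // ltW.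
rewrite [X in (_ - (X + _))%E](poisson_prob0 r0) [X in (_ - (_ + X))%E]p1.
rewrite -EFinD lee_fin; have := expR_ge1Dx (- r); nra.
Qed.

(** A repeated point puts two points into one cell of every grid. *)
Lemma negligible_multiple : P.-negligible [set x | ~~ uniq (Pi x)].
Proof.
pose A m i := [set x | [set j | (1 < j)%N] (num_points (gcell m i) (Pi x))].
pose E m := \big[setU/set0]_(i < m.+1) A m.+1 i.
apply: (@negligible_vanish _ E (lambda ^+ 2)).
- move=> m; apply: bigsetU_measurable => i _.
  by apply: (measurable_points hPi); exact: measurable_gcell.
- move=> m x /= nu.
  have [y ys y2] : exists2 y, y \in Pi x & (1 < count_mem y (Pi x))%N.
    have /allPn[y ys yc] : ~~ all (fun y => count_mem y (Pi x) == 1%N) (Pi x).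
      apply: contra nu => /allP h; apply: count_mem_uniq => z.
      by case: (boolP (z \in Pi x)) => [/h/eqP//|/count_memPn].
    exists y => //; rewrite ltn_neqAle eq_sym yc /= -has_count has_pred1.
    exact: ys.
  have y01 := Pi_gt0 hPi ys; have /andP[y0 _] := y01.
  have cy := cell_lt (ltn0Sn m) y01.
  rewrite /E -bigcup_mkord; exists (cell m.+1 y) => //=.
  apply: leq_trans y2 _; apply: sub_count => z /eqP ->.
  by apply/asboolP/(gcellP _ (ltn0Sn m) y0).
- move=> m; apply: le_trans (Boole_inequality P (A := A m.+1) _) _.
    by move=> i _; apply: (measurable_points hPi); exact: measurable_gcell.
  have mR : 0 < m.+1%:R :> R by rewrite ltr0n.
  apply: (@le_trans _ _ (\sum_(i < m.+1) ((lambda / m.+1%:R) ^+ 2)%:E)%E).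
    apply: lee_sum => i _; have := poisson_prob_ge2 (rate_gt0 lambda_gt0 (ltn0Sn m)).
    by rewrite -(points_prob hPi (ltn_ord i)).
  rewrite sumEFin lee_fin sumr_const card_ord -[leLHS]mulr_natl.
  rewrite le_eqVlt; apply/orP; left; apply/eqP; field.
  by rewrite lt0r_neq0.
Qed.

Lemma negligible_point (v : R) : P.-negligible [set x | v \in Pi x].
Proof.
have [v01|nv] := boolP (0 < v <= 1); last first.
  exists set0; split; [exact: measurable0 | exact: measure0 | ].
  by move=> x /= /(Pi_gt0 hPi); rewrite (negbTE nv).
have mv : measurable [set v] by exact: measurable_set1.
exists [set x | [set j | (0 < j)%N] (num_points [set v] (Pi x))]; split.
- exact: (measurable_points hPi).
- rewrite (pp_poisson hPi) //; last by move=> _ ->; rewrite /= in_itv.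
  rewrite lebesgue_measure_set1 /= mulr0 /poisson_prob ltxx.
  by rewrite diracE memNset.
- move=> x /= vx; rewrite -has_count; apply/hasP; exists v => //.
  exact/asboolP.
Qed.

End almost_sure.

(** * Limits of expectations over the grid *)

Lemma generic_cons (R : realType) (w u : R) (s : seq R) : 0 < w -> 0 < u <= 1 ->
  generic w s -> [/\ u \notin s, u + w \notin s, u - w \notin s,
    u + (w + w) \notin s & u - (w + w) \notin s] -> generic w (u :: s).
Proof.
move=> w0 u01 [sU s01 sw] [us us1 us2 us3 us4]; split.
- by rewrite /= us.
- by move=> y; rewrite inE => /predU1P[->|/s01].
move=> y z; rewrite !inE => /predU1P[->|ys] /predU1P[->|zs].
- by split; apply/eqP => uE; move: w0; lra.
- by split; [apply: contraNneq us1 => <-|apply: contraNneq us3 => <-].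
- split; [apply: contraNneq us2|apply: contraNneq us4] => ->; by rewrite addrK.
- exact: sw.
Qed.

Section limits.
Context d (T : measurableType d) (R : realType).
Variables (P : probability T R) (lambda : R) (Pi : T -> seq R).
Hypotheses (lambda_gt0 : 0 < lambda) (hPi : poisson_process P lambda Pi).
Variables (p q k : nat).
Hypotheses (p_gt0 : (0 < p)%N) (pq : (p < q)%N) (k2 : (2 <= k)%N).

Let w : R := p%:R / q%:R.
Let q_gt0 : (0 < q)%N. Proof. exact: leq_ltn_trans pq. Qed.
Let qR : 0 < q%:R :> R. Proof. by rewrite ltr0n. Qed.
Let w01 : 0 < w <= 1.
Proof.
by rewrite divr_gt0 ?ltr0n //= ler_pdivrMr // mul1r ler_nat ltnW.
Qed.
Let k_gt0 : (0 < k)%N. Proof. exact: ltnW. Qed.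

Lemma negligible_nongeneric : P.-negligible [set x | ~ generic w (Pi x)].
Proof.
have n1 := negligible_shift lambda_gt0 hPi q_gt0 p_gt0 (erefl w).
have w2 : w + w = (p + p)%N%:R / q%:R by rewrite natrD mulrDl.
have n2 := negligible_shift lambda_gt0 hPi q_gt0 (ltn_addr p p_gt0) w2.
have n3 := negligible_multiple lambda_gt0 hPi.
apply: negligibleS (negligibleU n3 (negligibleU n1 n2)) => x /= ng.
apply: contrapT => /not_orP[/negP/negPn nu /not_orP[h1 h2]]; apply: ng; split=> //.
  by move=> y; exact: (Pi_gt0 hPi).
move=> y z ys zs; split; apply/eqP => zE; [apply: h1|apply: h2]; by exists y, z.
Qed.

Lemma measurable_scan_event (l : seq R) : measurable [set x | (k <= scan w (l ++ Pi x))%N].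
Proof.
rewrite (_ : [set _ | _] = \bigcup_m \bigcup_i
    [set x | [&& (0 < m)%N, (i <= m * (q - p))%N &
              (k <= in_window w (l ++ Pi x) (i%:R / (m * q)%:R))%N]]).
  apply: bigcupT_measurable => m; apply: bigcupT_measurable => i.
  pose B : set R := `](i%:R / (m * q)%:R), (i%:R / (m * q)%:R + w)]%classic.
  pose U := [set j | [&& (0 < m)%N, (i <= m * (q - p))%N & (k <= num_points B l + j)%N]].
  rewrite (_ : [set _ | _] = [set x | U (num_points B (Pi x))]); last first.
    by apply/seteqP; split => x /=; rewrite /in_window /num_points count_cat.
  by apply: (measurable_points hPi); exact: measurable_itv.
apply/seteqP; split => x /=.
  move=> /(scan_grid k _ q_gt0 (ltnW pq) (erefl w))[m [i [m0 im ki]]].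
  by exists m => //; exists i => //=; apply/and3P.
case=> m _ [i _ /= /and3P[m0 im ki]].
by apply/(scan_grid k _ q_gt0 (ltnW pq) (erefl w)); exists m, i.
Qed.

(** Removing duplicates makes l ++ sites c the list of a set of sites, also when a
    site of l is already occupied. *)
Definition crowd_with (m : nat) (l : seq nat) (c : {set 'I_(m * q)}) : R :=
  (crowded (nearn (m * p)) k (undup (l ++ sites c)))%:R.

Lemma resolved_eventually (s : seq R) : generic w s ->
  \forall m \near \oo, [/\ (0 < m * q)%N, (m * q)%:R * w = (m * p)%:R &
    resolves (m * q) w s].
Proof.
move=> /generic_resolves[N HN]; exists N.+1 => // m /= Nm; split.
- by rewrite muln_gt0 q_gt0 andbT; lia.
- by rewrite !natrM /w; field; rewrite lt0r_neq0.
- by apply: HN; apply: leq_trans (ltnW Nm) _; rewrite leq_pmulr.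
Qed.

Lemma crowd_with_limit (l : seq R) (x : T) : generic w (l ++ Pi x) ->
  \forall m \near \oo, @crowd_with m [seq cell (m * q) y | y <- l] (occ Pi (m * q) x) =
    (k <= scan w (l ++ Pi x))%N%:R.
Proof.
move=> sG; have := resolved_eventually sG; apply: filterS => m [n0 nw sR].
rewrite /crowd_with scan_crowded //; last by case: sG.
congr (_ : bool)%:R; rewrite -(crowded_cells n0 nw sG sR); apply: crowded_perm.
apply: uniq_perm; [exact: undup_uniq | exact: (map_cell_uniq n0 sG sR) |].
by move=> i; rewrite mem_undup map_cat !mem_cat (mem_sites_occ hPi).
Qed.

Lemma crowd_with_cvg (l : seq R) :
  P.-negligible [set x | ~ generic w (l ++ Pi x)] ->
  (fun m => (bernE (fun=> occ_prob lambda (m * q))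
     (@crowd_with m [seq cell (m * q) y | y <- l]))%:E) @ \oo -->
  P [set x | (k <= scan w (l ++ Pi x))%N].
Proof.
move=> neg; rewrite prob_integral; last exact: measurable_scan_event.
have -> : (fun m => (bernE (fun=> occ_prob lambda (m * q))
     (@crowd_with m [seq cell (m * q) y | y <- l]))%:E) = (fun m =>
   \int[P]_x (@crowd_with m [seq cell (m * q) y | y <- l] (occ Pi (m * q) x))%:E)%E.
  by apply/funext => m; rewrite (occ_integral hPi lambda_gt0) //.
apply: (bounded_cvg_off_negligible (C := 1) _ _ _ neg) => //.
- move=> m; apply: measurable_finite_valued; exact: (measurable_occ hPi).
- by move=> m x; rewrite /crowd_with; case: crowded; rewrite /= ?lexx ?ler01.
- move=> x /contrapT /crowd_with_limit; apply: filterS => m ->.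
  by rewrite /= asboolb.
Qed.

Lemma scan_cvg : (fun m => (bernE (fun=> occ_prob lambda (m * q))
     (@crowd_with m [::]))%:E) @ \oo --> alpha P Pi w k.
Proof. exact/(crowd_with_cvg (l := [::]))/negligible_nongeneric. Qed.

Lemma scan_cons_cvg (u : R) : 0 < u <= 1 ->
  (fun m => (bernE (fun=> occ_prob lambda (m * q))
     (@crowd_with m [:: cell (m * q) u]))%:E) @ \oo -->
  P [set x | (k <= scan w (u :: Pi x))%N].
Proof.
move=> u01; apply: (crowd_with_cvg (l := [:: u])).
have npt v := negligible_point hPi v.
have := negligibleU negligible_nongeneric (negligibleU (npt u) (negligibleU (npt (u + w))
  (negligibleU (npt (u - w)) (negligibleU (npt (u + (w + w))) (npt (u - (w + w))))))).
apply: negligibleS => x /= ng; apply: contrapT.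
move=> /not_orP[/contrapT sG] /not_orP[h1] /not_orP[h2] /not_orP[h3] /not_orP[h4 h5].
by apply: ng; apply: generic_cons => //; [case/andP: w01 | split; apply/negP].
Qed.

(** On generic configurations without the point 1 - w the grid gain is eventually
    equal to nu + nu_tilde; the point 1 - w is excluded because nu sums over the points
    below it and the grid over the sites i with i + L < n. *)
Lemma gain_cvg : (fun m => (bernE (fun=> occ_prob lambda (m * q))
    (fun c : {set 'I_(m * q)} => (total_gain (m * q) (m * p) k (sites c))%:R))%:E) @ \oo -->
  ('E_P[fun x => (nu w k (Pi x) + nu_tilde w k (Pi x))%:R])%E.
Proof.
rewrite unlock.
have -> : (fun m => (bernE (fun=> occ_prob lambda (m * q))
    (fun c : {set 'I_(m * q)} => (total_gain (m * q) (m * p) k (sites c))%:R))%:E) = (fun m =>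
   \int[P]_x (total_gain (m * q) (m * p) k (sites (occ Pi (m * q) x)))%:R%:E)%E.
  by apply/funext => m; rewrite (occ_integral hPi lambda_gt0 (F := fun c : {set 'I_(m * q)} => (total_gain (m * q) (m * p) k (sites c))%:R)).
apply: (bounded_cvg_off_negligible (C := (2 * (q * k))%:R)
  (N := [set x | ~ generic w (Pi x)] `|` [set x | 1 - w \in Pi x])) => //.
- move=> m; apply: (measurable_finite_valued _ (fun c : {set 'I_(m * q)} =>
    (total_gain (m * q) (m * p) k (sites c))%:R)); exact: (measurable_occ hPi).
- move=> m x; rewrite ler0n ler_nat; apply: total_gain_le => //.
  + exact: sites_uniq.
  + by move=> i; exact: sites_lt.
- exact: negligibleU negligible_nongeneric (negligible_point hPi _).
- move=> x /not_orP[/contrapT sG /negP s1w]; have := resolved_eventually sG.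
  apply: filterS => m [n0 nw sR]; congr _%:R.
  rewrite -(total_gain_cells n0 nw sG sR w01 k2); last first.
    by move=> y ys; apply: contraNneq s1w => <-.
  apply: total_gain_perm; apply: uniq_perm; first exact: sites_uniq.
    exact: (map_cell_uniq n0 sG sR).
  exact: (mem_sites_occ hPi).
Qed.

End limits.

(** * Taylor bounds for the exponential and limits along halvings *)

Section taylor.
Variable R : realType.

(** Used twice in a row: each bound for exp(-x) is integrated to the next one. *)
Lemma le_of_is_derive (f g : R -> R) (x : R) : (forall y : R, is_derive y 1 f (g y)) ->
  (forall y, 0 <= y -> 0 <= g y) -> 0 <= x -> f 0 <= f x.
Proof.
move=> fg g0 x0; apply: (@ger0_derive1_ndecry R f 0) => //.
- move=> y; rewrite in_itv /= andbT => y0; rewrite derive1E.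
  by case: (fg y) => _ ->; exact/g0/ltW.
- apply: continuous_subspaceT => y; apply: differentiable_continuous.
  by apply/derivable1_diffP; case: (fg y).
Qed.

Lemma expRN_taylor2 (x : R) : 0 <= x -> expR (- x) <= 1 - x + x ^+ 2 / 2.
Proof.
move=> x0.
pose f := fun y : R => y ^+ 2 / 2 - y - expR (- y).
pose g := fun y : R => y - 1 + expR (- y).
have fg (y : R) : is_derive y 1 f (g y).
  rewrite /f /g; apply: is_derive_eq.
  have sE (a b : R) : a *: (b : R^o) = a * b by [].
  by rewrite !sE; field.
have := le_of_is_derive fg _ x0; rewrite /f /g oppr0 expR0.
have h (y : R) : 0 <= y -> 0 <= y - 1 + expR (- y).
  by move=> y0; have := expR_ge1Dx (- y); lra.
by move=> /(_ h); rewrite expr0n /=; lra.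
Qed.

Lemma expRN_taylor3 (x : R) : 0 <= x -> 1 - x + x ^+ 2 / 2 - x ^+ 3 / 6 <= expR (- x).
Proof.
move=> x0.
pose f := fun y : R => y ^+ 3 / 6 - y ^+ 2 / 2 + y + expR (- y).
pose g := fun y : R => y ^+ 2 / 2 - y + 1 - expR (- y).
have fg (y : R) : is_derive y 1 f (g y).
  rewrite /f /g; apply: is_derive_eq.
  have sE (a b : R) : a *: (b : R^o) = a * b by [].
  by rewrite !sE; field.
have := le_of_is_derive fg _ x0; rewrite /f /g oppr0 expR0.
have h (y : R) : 0 <= y -> 0 <= y ^+ 2 / 2 - y + 1 - expR (- y).
  by move=> y0; have := expRN_taylor2 y0; lra.
by move=> /(_ h); rewrite !expr0n /=; lra.
Qed.

End taylor.

Lemma cvg_of_le (R : realType) (u : nat -> R) (l C : R) :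
  (\forall m \near \oo, `|u m - l| <= C / m%:R) -> u @ \oo --> l.
Proof.
move=> h; apply/cvgrPdist_le => e e0.
near=> m; have m0 : 0 < m%:R :> R by rewrite ltr0n; near: m; exists 1%N.
rewrite distrC; apply: (@le_trans _ _ (C / m%:R)); first by near: m.
rewrite ler_pdivrMr // mulrC -ler_pdivrMr //; near: m.
exists (Num.bound `|C / e|) => // m /= bm; apply: le_trans (ler_norm _) _.
by apply: ltW (lt_le_trans (archi_boundP (normr_ge0 _)) _); rewrite ler_nat.
Unshelve. all: by end_near. Qed.

(** Correct A by the conjectured first-order term 2 kappa / c.  The corrected sequence
    changes by at most (e/2) / c m from m to 2m, hence by at most e / c m along all
    later doublings, whose limit is l. *)
Lemma halving_limit (R : realType) (A c : nat -> R) (l kappa : R) :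
  (forall m, c m.*2 = 2 * c m) -> (forall m, (0 < m)%N -> 0 < c m) ->
  A @ \oo --> l -> (fun m => c m * (A m.*2 - A m)) @ \oo --> kappa ->
  (fun m => c m * (l - A m)) @ \oo --> 2 * kappa.
Proof.
move=> c2 c0 Al /cvgrPdist_le Ak; apply/cvgrPdist_le => e e0.
have e2 : 0 < e / 2 by rewrite divr_gt0.
have [N _ HN] := Ak _ e2.
exists N.+1 => // m /= Nm.
have cK m' : (0 < m')%N -> c m' != 0 by move=> m'0; rewrite gt_eqF // c0.
have step m' : (N <= m')%N -> (0 < m')%N ->
    `|A m'.*2 - A m' - kappa / c m'| <= (e / 2) / c m'.
  move=> Nm' m'0; have cm := c0 _ m'0; have := HN _ Nm'.
  have -> : kappa - c m' * (A m'.*2 - A m') = - c m' * (A m'.*2 - A m' - kappa / c m').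
    by field; exact: cK.
  rewrite normrM normrN (gtr0_norm cm) => h.
  by rewrite ler_pdivlMr // mulrC.
(* The bound e / c m' is the sum of the geometric series of the steps. *)
have tele j : forall m', (N <= m')%N -> (0 < m')%N ->
    `|(A (2 ^ j * m')%N + 2 * kappa / c (2 ^ j * m')%N) - (A m' + 2 * kappa / c m')|
      <= e / c m'.
  elim: j => [|j IH] m' Nm' m'0.
    by rewrite expn0 mul1n subrr normr0 divr_ge0 ?ltW // c0.
  have m20 : (0 < m'.*2)%N by lia.
  have := IH m'.*2 _ m20; have := step _ Nm' m'0.
  have -> : (2 ^ j * m'.*2 = 2 ^ j.+1 * m')%N by rewrite expnS -mul2n; lia.
  rewrite c2.
  have -> : e / (2 * c m') = e / c m' - e / 2 / c m' by field; exact: cK.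
  have -> : 2 * kappa / (2 * c m') = kappa / c m' by field; exact: cK.
  have -> : 2 * kappa / c m' = kappa / c m' + kappa / c m' by field; exact: cK.
  move=> h1 /(_ (leq_trans Nm' _)) h2.
  have {}h2 := h2 ltac:(by rewrite -addnn leq_addr).
  rewrite !ler_norml in h1 h2 *; lra.
have m0 : (0 < m)%N by apply: leq_ltn_trans Nm.
have cm := c0 _ m0.
have cpow j : c (2 ^ j * m)%N = 2 ^+ j * c m.
  by elim: j => [|j IH]; rewrite ?expn0 ?mul1n ?expr0 ?mul1r // expnS -mulnA mul2n c2 IH exprS mulrA.
pose v := A m + 2 * kappa / c m.
pose u j := A (2 ^ j * m)%N + 2 * kappa / c (2 ^ j * m)%N.
have jle j : (j <= 2 ^ j * m)%N by apply: leq_trans (ltnW (ltn_expl j (ltnSn 1))) _; rewrite leq_pmulr.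
have u1 : (fun j => A (2 ^ j * m)%N) @ \oo --> l.
  apply/cvgrPdist_le => d d0; have /cvgrPdist_le/(_ _ d0)[M _ HM] := Al.
  by exists M => // j /= Mj; apply: HM; exact: leq_trans Mj (jle j).
have u2 : (fun j => 2 * kappa / c (2 ^ j * m)%N) @ \oo --> (0 : R).
  apply: (@cvg_of_le _ _ _ (`|2 * kappa| / c m)); exists 1%N => // j /= j0.
  rewrite subr0 cpow normrM normfV (gtr0_norm (_ : 0 < 2 ^+ j * c m)); last first.
    by rewrite mulr_gt0 // exprn_gt0.
  rewrite -mulrA ler_wpM2l // -invfM lef_pV2 ?posrE ?mulr_gt0 ?exprn_gt0 ?ltr0n //.
  have j2 : j%:R <= 2 ^+ j :> R by rewrite -(natrX R 2 j) ler_nat; exact/ltnW/ltn_expl.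
  by rewrite mulrC ler_wpM2r // ltW.
have u3 : (fun j => `|u j - v|) @ \oo --> `|l - v|.
  by apply: cvg_norm; apply: cvgB; [rewrite -[l]addr0; exact: cvgD | exact: cvg_cst].
have le : `|l - v| <= e / c m.
  rewrite -(cvg_lim _ u3) //; apply: limr_le; first by apply/cvg_ex; exists `|l - v|.
  by apply: nearW => j; apply: tele => //; exact: ltnW.
have -> : 2 * kappa - c m * (l - A m) = - c m * (l - v).
  by rewrite /v; field; exact: cK.
by rewrite normrM normrN (gtr0_norm cm) mulrC -ler_pdivlMr.
Qed.

(** * The integral over the position of an added point *)

Section riemann.
Variable R : realType.
Local Notation mu := (@lebesgue_measure R).

(** On ]0, 1] the cells form a partition. *)
Lemma step_fun_cells (n : nat) (y : nat -> R) (u : R) : (0 < n)%N -> 0 < u <= 1 ->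
  y (cell n u) = \sum_(i < n) y i * \1_(gcell n i) u.
Proof.
move=> n0 u01; have /andP[u0 _] := u01; pose i := Ordinal (cell_lt n0 u01).
rewrite (bigD1 i) //= indicE mem_set; last exact/(gcellP _ n0 u0).
rewrite mulr1 big1 ?addr0 // => j ji; rewrite indicE memNset ?mulr0 //.
by move=> /(gcellP _ n0 u0) cj; move/eqP: ji; apply; apply: val_inj.
Qed.

Lemma measurable_step_fun (n : nat) (y : nat -> R) : (0 < n)%N ->
  measurable_fun `](0 : R), (1 : R)] (fun u : R => (y (cell n u))%:E).
Proof.
move=> n0; apply: (eq_measurable_fun (fun u => (\sum_(i < n) y i * \1_(gcell n i) u)%:E)).
  by move=> u; rewrite inE /= in_itv /= => u01; rewrite -step_fun_cells.
apply/measurable_EFinP; apply: measurable_sum => i; apply: measurable_funM => //.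
by apply: measurable_indic; exact: measurable_gcell.
Qed.

Lemma integral_step_fun (n : nat) (y : nat -> R) : (0 < n)%N -> (forall i, 0 <= y i) ->
  (\int[mu]_(u in `]0%R, 1%R]) (y (cell n u))%:E = (n%:R^-1 * \sum_(i < n) y i)%:E)%E.
Proof.
move=> n0 y0.
transitivity (\int[mu]_(u in `]0%R, 1%R])
    (\sum_(i <- enum 'I_n) (y i * \1_(gcell n i) u)%:E))%E.
  apply: eq_integral => u; rewrite inE /= in_itv /= => u01.
  by rewrite sumEFin big_enum /= -step_fun_cells.
rewrite ge0_integral_sum //.
- rewrite big_enum /= mulr_sumr -sumEFin; apply: eq_bigr => i _.
  under eq_integral do rewrite EFinM.
  rewrite ge0_integralZl //; last 2 first.
  + by apply/measurable_EFinP; apply: measurable_indic; exact: measurable_gcell.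
  + by rewrite lee_fin.
  rewrite integral_indic //; last exact: measurable_gcell.
  have -> : (gcell n i `&` `]0%R, 1%R] : set R) = gcell n i.
    by apply/seteqP; split => [u []//|u ui]; split=> //; exact: gcell_sub ui.
  by rewrite [X in (_ * X)%E](lebesgue_gcell R i n0) -EFinM mulrC.
- move=> i; apply/measurable_EFinP; apply: measurable_funM => //.
  by apply: measurable_indic; exact: measurable_gcell.
- by move=> i u _; rewrite lee_fin mulr_ge0 // indicE.
Qed.

End riemann.

Section riemann_limit.
Context d (T : measurableType d) (R : realType).
Variables (P : probability T R) (lambda : R) (Pi : T -> seq R).
Hypotheses (lambda_gt0 : 0 < lambda) (hPi : poisson_process P lambda Pi).
Variables (p q k : nat).
Hypotheses (p_gt0 : (0 < p)%N) (pq : (p < q)%N) (k2 : (2 <= k)%N).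
Local Notation w := (p%:R / q%:R : R).

Lemma crowd_with_itv01 m l : 0 <= bernE (fun=> occ_prob lambda (m * q))
  (@crowd_with R p q k m l) <= 1.
Proof.
apply: bernE_itv01 => [_|c]; first exact: occ_prob01.
by rewrite /crowd_with; case: crowded; rewrite ?lexx ?ler01.
Qed.

(** The average over the sites is the integral over u of a function of the cell of u,
    which converges for every u in ]0, 1] by [scan_cons_cvg]. *)
Lemma mean_cons_cvg : (fun m => ((m * q)%:R^-1 * \sum_(i < m * q)
     bernE (fun=> occ_prob lambda (m * q)) (@crowd_with R p q k m [:: val i]))%:E) @ \oo -->
  (\int[lebesgue_measure]_(u in `[0%R, 1%R]) P [set x | (k <= scan w (u :: Pi x))%N])%E.
Proof.
have q_gt0 : (0 < q)%N by apply: leq_ltn_trans pq.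
pose y m i := bernE (fun=> occ_prob lambda (m * q)) (@crowd_with R p q k m [:: i]).
have y01 m i : 0 <= y m i <= 1 by exact: crowd_with_itv01.
pose f_ m (u : R) := (y m.+1 (cell (m.+1 * q) u))%:E.
pose f (u : R) := P [set x | (k <= scan w (u :: Pi x))%N].
have n0 m : (0 < m.+1 * q)%N by rewrite muln_gt0.
have mf_ m : measurable_fun `](0 : R), (1 : R)] (f_ m) by exact: measurable_step_fun.
have ff u : `]0%R, 1%R]%classic u -> f_ ^~ u @ \oo --> f u.
  rewrite /= in_itv /= => u01; rewrite /f_.
  rewrite (cvg_shiftS (fun m => (y m (cell (m * q) u))%:E)).
  exact: (scan_cons_cvg lambda_gt0 hPi p_gt0 pq k2 u01).
have mf : measurable_fun `](0 : R), (1 : R)] f by exact: (emeasurable_fun_cvg f_).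
rewrite -(integral_itv_obnd_cbnd mf) -(cvg_shiftS (fun m => ((m * q)%:R^-1 * _)%:E)).
have -> : (fun m => ((m.+1 * q)%:R^-1 * \sum_(i < m.+1 * q) y m.+1 i)%:E) =
    (fun m => \int[lebesgue_measure]_(u in `]0%R, 1%R]) f_ m u)%E.
  apply/funext => m; rewrite integral_step_fun //.
  by move=> i; case/andP: (y01 m.+1 i).
have [] := @dominated_convergence _ _ _ lebesgue_measure _ _ f_ f (cst 1%E) mf_ mf => //.
- by apply: aeW => u; exact: ff.
- apply: (@measurable_bounded_integrable _ _ _ _ (cst 1)) => //.
    by rewrite [ltLHS]lebesgue_measure_itv /= lte01 -EFinB ltry.
  exact: bounded_cst.
- by apply: aeW => u m _; have /andP[h0 h1] := y01 m.+1 (cell (m.+1 * q) u); rewrite /f_ /= lee_fin ger0_norm.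
Qed.

End riemann_limit.

(** * The discrete scan probability *)

Lemma leq_bigmax_has (k : nat) (r : seq nat) (F : nat -> nat) : (0 < k)%N ->
  (k <= \max_(i <- r) F i)%N = has (fun i => (k <= F i)%N) r.
Proof.
move=> k0; elim: r => [|i r IH]; first by rewrite big_nil leqNgt k0.
by rewrite big_cons leq_max IH.
Qed.

(** A window anchored too far to the right is contained in the last window of the
    grid. *)
Lemma has_window_crowded (L n k : nat) (s : seq nat) : (L <= n)%N -> (0 < k)%N ->
  {in s, forall j, (j < n)%N} ->
  has (fun i => (k <= count (fun j => i <= j < i + L) s)%N) (iota 0 (n - L).+1) =
  crowded (nearn L) k s.
Proof.
move=> Ln k0 sn; apply/hasP/idP => [[i _ ki]|/hasP[x xs kx]].
  by apply/negPn/negP => /(count_window_lt i k0); rewrite ltnNge ki.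
exists (minn x (n - L)); first by rewrite mem_iota; lia.
apply: leq_trans kx _.
apply: (@leq_trans (count (fun j => (j \in s) && nearn L x j) s)).
  by apply/eq_leq/eq_in_count => j js; rewrite js.
by apply: sub_count => j /andP[/sn jn]; rewrite /nearn; lia.
Qed.

Lemma measurable_sum_nat d (T : measurableType d) (h : nat -> T -> nat) (l : seq nat) :
  (forall r, r \in l -> forall U : set nat, measurable (h r @^-1` U)) ->
  forall U : set nat, measurable [set x | U (\sum_(r <- l) h r x)%N].
Proof.
elim: l => [|r l IH] ml U.
  under eq_set do rewrite big_nil; have [U0|nU0] := pselect (U 0%N).
    by rewrite (_ : [set _ | _] = setT) //; apply/seteqP; split.
  by rewrite (_ : [set _ | _] = set0) //; apply/seteqP; split.
rewrite (_ : [set _ | _] = \bigcup_j (h r @^-1` [set j] `&`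
    [set x | [set i | U (j + i)%N] (\sum_(r <- l) h r x)%N])).
  apply: bigcupT_measurable => j; apply: measurableI; first exact/ml/mem_head.
  by apply: IH => i il; apply: ml; rewrite inE il orbT.
apply/seteqP; split => x /=; rewrite big_cons; first by move=> Ux; exists (h r x).
by case=> j _ [/= ->].
Qed.

Section bernoulli_law.
Context d (T : measurableType d) (R : realType).
Variables (P : probability T R) (n L k : nat) (a : R) (h : nat -> T -> nat).
Hypotheses (hH : iid_bernoulli P n a h) (Ln : (L <= n)%N) (k_gt0 : (0 < k)%N).

(** Trials are numbered from 1 and sites from 0.  A trial may take values other than 0
    and 1 on a null set; there any nonzero value counts as a success. *)
Definition successes (x : T) : {set 'I_n} := [set i : 'I_n | (0 < h i.+1 x)%N].

Lemma measurable_trial (i : 'I_n) (U : set nat) : measurable (h i.+1 @^-1` U).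
Proof.
have mh := ib_measurable hH (ltn_ord i : (0 < i.+1 <= n)%N).
by rewrite -[_ @^-1` _]setTI; apply: mh.
Qed.

Lemma successes_fiber (c : {set 'I_n}) : successes @^-1` [set c] =
  \bigcap_(i in [set: 'I_n]) (h i.+1 @^-1` [set j : nat | (i \in c) = (0 < j)%N]).
Proof.
apply/seteqP; split => [x <- i _ /=|x hx]; first by rewrite inE.
by apply/setP => i; rewrite inE; apply/esym/hx.
Qed.

Lemma measurable_successes (c : {set 'I_n}) : measurable (successes @^-1` [set c]).
Proof.
rewrite successes_fiber; apply: fin_bigcap_measurable; first exact: finite_finset.
by move=> i _; exact: measurable_trial.
Qed.

Lemma successes_law (c : {set 'I_n}) :
  P (successes @^-1` [set c]) = (bernw (fun=> a) c)%:E.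
Proof.
rewrite successes_fiber (ib_independent hH) //.
rewrite /bernw -prodEFin; apply: eq_bigr => i _.
have i_n : (0 < i.+1 <= n)%N by exact: ltn_ord.
have pz := ib_zero hH i_n.
case: (boolP (i \in c)) => ic; last first.
  rewrite (_ : _ @^-1` _ = [set x | h i.+1 x = 0%N]) ?pz //.
  by apply/seteqP; split => x /=; case: (h i.+1 x).
rewrite (_ : _ @^-1` _ = ~` (h i.+1 @^-1` [set 0%N])); last first.
  by apply/seteqP; split => x /=; case: (h i.+1 x).
rewrite probability_setC; last exact: measurable_trial.
by rewrite [X in (_ - X)%E]pz -EFinD subKr.
Qed.

Lemma negligible_not01 (i : 'I_n) : P.-negligible [set x | (1 < h i.+1 x)%N].
Proof.
have i_n : (0 < i.+1 <= n)%N by exact: ltn_ord.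
exists (~` ((h i.+1 @^-1` [set 0%N]) `|` (h i.+1 @^-1` [set 1%N]))); split.
- by apply: measurableC; apply: measurableU; exact: measurable_trial.
- rewrite probability_setC; last by apply: measurableU; exact: measurable_trial.
  rewrite measureU; [|exact: measurable_trial|exact: measurable_trial|]; last first.
    by apply/seteqP; split => x //= [->].
  rewrite [X in (_ - (X + _))%E](ib_zero hH i_n) [X in (_ - (_ + X))%E](ib_one hH i_n).
  by rewrite -EFinD subrK subrr.
- by move=> x /=; case: (h i.+1 x) => [|[|j]] // _ [].
Qed.

Lemma negligible_some_not01 : P.-negligible [set x | exists i : 'I_n, (1 < h i.+1 x)%N].
Proof.
pose N (i : nat) := [set x | (0 < i <= n)%N && (1 < h i x)%N].
apply: (@negligibleS _ _ _ _ (\bigcup_i N i)).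
  by move=> x /= [i hi]; exists i.+1 => //=; rewrite /N /= ltn_ord hi.
apply: negligible_bigcup => -[|i]; first by apply: negligibleS (negligible_set0 P) => x.
have [i_n|ni] := ltnP i n; last first.
  by apply: negligibleS (negligible_set0 P) => x; rewrite /N /=; lia.
by apply: negligibleS (negligible_not01 (Ordinal i_n)) => x; rewrite /N /= => /andP[].
Qed.

Definition window_event : set T := [set x | (k <= \max_(1 <= i < (n - L).+2)
                     \sum_(i <= r < i + L) h r x)%N].

Lemma window_eventE (x : T) : (k <= \max_(1 <= i < (n - L).+2)
    \sum_(i <= r < i + L) h r x)%N =
  has (fun i => (k <= \sum_(i.+1 <= r < i.+1 + L) h r x)%N) (iota 0 (n - L).+1).
Proof.
rewrite leq_bigmax_has // /index_iota subSS subn0.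
by rewrite -[iota 1 _]/(iota (1 + 0) _) iotaDl has_map.
Qed.

Lemma measurable_window_event : measurable window_event.
Proof.
pose W i := [set x | (k <= \sum_(i.+1 <= r < i.+1 + L) h r x)%N].
rewrite (_ : window_event = \big[setU/set0]_(i < (n - L).+1) W i); last first.
  rewrite -bigcup_mkord; apply/seteqP; split => x.
    rewrite /window_event /= window_eventE => /hasP[i]; rewrite mem_iota => i_n ki.
    by exists i => //=; move: i_n; rewrite add0n.
  case=> i /= i_n ki; rewrite /window_event /= window_eventE; apply/hasP; exists i => //.
  by rewrite mem_iota.
apply: bigsetU_measurable => i _.
apply: (measurable_sum_nat (h := h) (l := index_iota i.+1 (i.+1 + L)) _ [set j | (k <= j)%N]).
move=> r; rewrite mem_index_iota => ri V.
have r_n : (r.-1 < n)%N by have := ltn_ord i; lia.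
by have := measurable_trial (Ordinal r_n) V; rewrite /= prednK //; lia.
Qed.

Lemma window_event_crowded (x : T) : (forall i : 'I_n, (h i.+1 x <= 1)%N) ->
  (k <= \max_(1 <= i < (n - L).+2) \sum_(i <= r < i + L) h r x)%N =
  crowded (nearn L) k (sites (successes x)).
Proof.
move=> h01; rewrite window_eventE -(has_window_crowded Ln k_gt0) => [|j]; last exact: sites_lt.
apply: eq_in_has => i; rewrite mem_iota add0n => /andP[_ iL]; congr (k <= _)%N.
have -> : index_iota i.+1 (i.+1 + L) = map succn (iota i L).
  by rewrite /index_iota addKn -[i.+1]add1n iotaDl.
rewrite big_map.
have -> : (\sum_(j <- iota i L) h j.+1 x =
    \sum_(j <- iota i L) (j \in sites (successes x)))%N.
  apply: eq_big_seq => j; rewrite mem_iota => ij; have j_n : (j < n)%N by lia.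
  rewrite -[j in j \in _]/(val (Ordinal j_n)) mem_sites inE /=.
  by have := h01 (Ordinal j_n); case: (h j.+1 x) => [|[]].
rewrite -big_mkcond sum1_count -!size_filter; apply: perm_size; apply: uniq_perm.
- by rewrite filter_uniq // iota_uniq.
- by rewrite filter_uniq // sites_uniq.
- by move=> j; rewrite !mem_filter mem_iota /= andbC.
Qed.

(** Off the null set where some trial exceeds 1, the window sums count successes. *)
Lemma beta_law : beta P n L k h =
  (bernE (fun=> a) (fun c : {set 'I_n} => (crowded (nearn L) k (sites c))%:R))%:E.
Proof.
rewrite /beta prob_integral; last exact: measurable_window_event.
rewrite -(integral_finite_valued measurable_successes successes_law) //.
have [N [mN PN neg]] := negligible_some_not01.
rewrite [LHS](integral_off_negligible mN PN) // [RHS](integral_off_negligible mN PN) //.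
apply: eq_integral => x _; congr EFin; rewrite !indicE.
have [xN|xN] := pselect (N x).
  have -> : (x \in ~` N) = false by apply: memNset => nx; exact: nx xN.
  by rewrite /= !mulr0.
rewrite mem_set // !mulr1 asboolb window_event_crowded // => i.
by rewrite leqNgt; apply/negP => hi; apply: xN; apply: neg; exists i.
Qed.

End bernoulli_law.

(** * First-order expansions *)

(** Turns limits in the extended reals into limits of reals. *)
Lemma bounded_ecvg (R : realType) (u : nat -> R) (l : \bar R) (C : R) :
  (forall m, 0 <= u m <= C) -> (fun m => (u m)%:E) @ \oo --> l ->
  l = (fine l)%:E /\ u @ \oo --> fine l.
Proof.
move=> uC ul.
have l0 : (0 <= l)%E.
  rewrite -(cvg_lim _ ul) //; apply: lime_ge; first by apply/cvg_ex; exists l.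
  by apply: nearW => m; rewrite lee_fin; case/andP: (uC m).
have lC : (l <= C%:E)%E.
  rewrite -(cvg_lim _ ul) //; apply: lime_le; first by apply/cvg_ex; exists l.
  by apply: nearW => m; rewrite lee_fin; case/andP: (uC m).
have lf : l \is a fin_num by rewrite ge0_fin_numE //; apply: le_lt_trans lC (ltry _).
split; first by rewrite fineK.
have := @fine_cvg _ _ _ _ (EFin \o u) (fine l); rewrite fineK //; apply; exact: ul.
Qed.

Section rates.
Variables (R : realType) (lambda : R).
Hypothesis lambda_gt0 : 0 < lambda.

Lemma occ_prob_rate n : (0 < n)%N ->
  `|n%:R * occ_prob lambda n - lambda| <= (lambda ^+ 2 / 2) / n%:R.
Proof.
move=> n0; have nR : 0 < n%:R :> R by rewrite ltr0n.
have x0 : 0 <= lambda / n%:R by rewrite divr_ge0 // ltW.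
have h1 := expRN_taylor2 x0; have h2 := expR_ge1Dx (- (lambda / n%:R)).
set x := lambda / n%:R in x0 h1 h2 *.
have -> : lambda = n%:R * x by rewrite /x mulrC divfK // lt0r_neq0.
rewrite /occ_prob -/x (_ : n%:R * x / n%:R = x); last by rewrite mulrC mulKf // lt0r_neq0.
have -> : ((n%:R * x) ^+ 2 / 2) / n%:R = n%:R * (x ^+ 2 / 2) by field; rewrite lt0r_neq0.
rewrite -mulrBr normrM (gtr0_norm nR) ler_wpM2l ?(ltW nR) // ler_norml.
have : 0 <= x ^+ 2 by rewrite sqr_ge0.
by lra.
Qed.

Lemma occ_prob_rate2 n : (0 < n)%N ->
  `|n%:R ^+ 2 * (occ_prob lambda n - lambda / n%:R) - - (lambda ^+ 2 / 2)| <=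
  (lambda ^+ 3 / 6) / n%:R.
Proof.
move=> n0; have nR : 0 < n%:R :> R by rewrite ltr0n.
have x0 : 0 <= lambda / n%:R by rewrite divr_ge0 // ltW.
have h1 := expRN_taylor2 x0; have h2 := expRN_taylor3 x0.
set x := lambda / n%:R in x0 h1 h2 *.
have -> : lambda = n%:R * x by rewrite /x mulrC divfK // lt0r_neq0.
rewrite /occ_prob -/x (_ : n%:R * x / n%:R = x); last by rewrite mulrC mulKf // lt0r_neq0.
have -> : ((n%:R * x) ^+ 3 / 6) / n%:R = n%:R ^+ 2 * (x ^+ 3 / 6) by field; rewrite lt0r_neq0.
have -> : n%:R ^+ 2 * (1 - expR (- x) - x) - - ((n%:R * x) ^+ 2 / 2) =
    n%:R ^+ 2 * (1 - expR (- x) - x + x ^+ 2 / 2) by field.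
rewrite normrM ger0_norm ?sqr_ge0 // ler_wpM2l ?sqr_ge0 // ler_norml.
have : 0 <= x ^+ 3 by rewrite exprn_ge0.
by lra.
Qed.

End rates.

Section assembly.
Context d (T : measurableType d) (R : realType).
Variables (P : probability T R) (lambda : R) (Pi : T -> seq R).
Hypotheses (lambda_gt0 : 0 < lambda) (hPi : poisson_process P lambda Pi).

(** Both sides are the expectation of F at the coarse occupied cells of Pi. *)
Lemma bernE_coarse n (F : {set 'I_n} -> R) : (0 < n)%N ->
  bernE (fun=> occ_prob lambda n.*2) (fun e => F (coarse e)) =
  bernE (fun=> occ_prob lambda n) F.
Proof.
move=> n0.
have ge0 (G : {set 'I_n} -> R) : (forall c, 0 <= G c) ->
    bernE (fun=> occ_prob lambda n.*2) (fun e => G (coarse e)) =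
    bernE (fun=> occ_prob lambda n) G.
  move=> G0; apply: EFin_inj.
  rewrite -(occ_integral hPi lambda_gt0) // -(occ_integral hPi lambda_gt0) //.
  by apply: eq_integral => x _; rewrite (coarse_occ hPi).
(* The constant K makes F nonnegative. *)
pose K : R := \sum_c `|F c|.
have KF c : 0 <= F c + K.
  rewrite /K (bigD1 c) //= addrA addr_ge0 ?sumr_ge0 //.
  by have := ler_norm (- F c); rewrite normrN; lra.
have := ge0 _ KF; rewrite (bernED _ (fun e => F (coarse e)) (fun=> K)) bernED !bernE_cst.
exact: addIr.
Qed.

Variables (p q k : nat).
Hypotheses (p_gt0 : (0 < p)%N) (pq : (p < q)%N).
Let q_gt0 : (0 < q)%N. Proof. exact: leq_ltn_trans pq. Qed.

Definition grid_scan (n L : nat) : R := bernE (fun _ : 'I_n => occ_prob lambda n)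
  (fun c => (crowded (nearn L) k (sites c))%:R).

Definition mean_gain (n L : nat) : R := bernE (fun _ : 'I_n => occ_prob lambda n)
  (fun c => (total_gain n L k (sites c))%:R).

(** The leading term comes from [bernE_sum_bad_gain]; the error is that of
    [defect_approx], estimated by [bernE_double_bad] and b <= lambda / (2n). *)
Lemma grid_scan_refine n L : (0 < n)%N -> (0 < L)%N ->
  `|grid_scan n.*2 L.*2 - grid_scan n L -
    occ_prob lambda n.*2 ^+ 2 / occ_prob lambda n * mean_gain n L| <=
  (lambda ^+ 4 / 2 + lambda ^+ 3) / n%:R ^+ 2.
Proof.
move=> n0 L0; set a := occ_prob lambda n; set b := occ_prob lambda n.*2.
have nR : 0 < n%:R :> R by rewrite ltr0n.
have b01 : 0 <= b <= 1 := occ_prob01 lambda_gt0 _.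
have a0 : 0 < a.
  rewrite /a /occ_prob subr_gt0 expR_lt1 oppr_lt0 divr_gt0 //.
have main := bernE_sum_bad_gain k L0 b01 (fun F => bernE_coarse F n0).
have -> : b ^+ 2 / a * mean_gain n L =
    bernE (fun=> b) (fun e : {set 'I_(n.*2)} => \sum_(u < n.*2) (bad_gain L k u e)%:R).
  by apply: (mulfI (lt0r_neq0 a0)); rewrite [RHS]main /mean_gain; field; rewrite lt0r_neq0.
have -> : grid_scan n L = bernE (fun=> b)
    (fun e : {set 'I_(n.*2)} => (crowded (nearn L) k (sites (coarse e)))%:R).
  by rewrite (bernE_coarse (fun c : {set 'I_n} => (crowded (nearn L) k (sites c))%:R) n0).
rewrite /grid_scan -!bernEB.
apply: (@le_trans _ _ (bernE (fun=> b) (fun e : {set 'I_(n.*2)} => 2 * double_bad R L e))).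
  by apply: ler_norm_bernE => [_ //|e]; exact: defect_approx.
rewrite bernEZ.
apply: (@le_trans _ _ (2 * ((n.*2%:R * b ^+ 2) ^+ 2 + 2 * n.*2%:R * b ^+ 3))).
  by rewrite ler_wpM2l // bernE_double_bad.
have b_le : b <= lambda / n.*2%:R := occ_prob_le _ _.
have b0 : 0 <= b by case/andP: b01.
have -> : n.*2%:R = 2 * n%:R :> R by rewrite -mul2n natrM.
have {}b_le : b <= lambda / (2 * n%:R) by move: b_le; rewrite -mul2n natrM.
set x := lambda / (2 * n%:R) in b_le.
have b2 : b ^+ 2 <= x ^+ 2 by rewrite ler_pXn2r ?nnegrE //; exact: le_trans b_le.
have b3 : b ^+ 3 <= x ^+ 3 by rewrite ler_pXn2r ?nnegrE //; exact: le_trans b_le.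
have n2 : 0 <= 2 * n%:R :> R by rewrite mulr_ge0.
have s1 : (2 * n%:R * b ^+ 2) ^+ 2 <= (2 * n%:R * x ^+ 2) ^+ 2.
  by rewrite ler_pXn2r ?nnegrE ?(mulr_ge0 n2 (sqr_ge0 _)) // ler_wpM2l.
have s2 : 2 * (2 * n%:R) * b ^+ 3 <= 2 * (2 * n%:R) * x ^+ 3.
  by rewrite ler_wpM2l // mulr_ge0.
apply: (@le_trans _ _ (2 * ((2 * n%:R * x ^+ 2) ^+ 2 + 2 * (2 * n%:R) * x ^+ 3))); first by lra.
rewrite /x.
have -> : 2 * ((2 * n%:R * (lambda / (2 * n%:R)) ^+ 2) ^+ 2 +
     2 * (2 * n%:R) * (lambda / (2 * n%:R)) ^+ 3) =
  (lambda ^+ 4 / 2 + lambda ^+ 3) / n%:R ^+ 2.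
  by field; rewrite lt0r_neq0.
by [].
Qed.


Let n_gt0 m : (0 < m)%N -> (0 < m * q)%N. Proof. by rewrite muln_gt0 q_gt0 andbT. Qed.

Lemma cvg_grid (u : nat -> R) (l C : R) : 0 <= C ->
  (forall m, (0 < m)%N -> lambda <= (m * q)%:R -> `|u m - l| <= C / (m * q)%:R) ->
  u @ \oo --> l.
Proof.
move=> C0 h; apply: (@cvg_of_le _ _ _ C); exists (Num.bound lambda).+1 => // m /= lm.
have m0 : (0 < m)%N by apply: leq_ltn_trans lm.
have mq : lambda <= (m * q)%:R.
  apply: ltW (lt_le_trans (archi_boundP (ltW lambda_gt0)) _); rewrite ler_nat.
  by apply: leq_trans (ltnW lm) _; rewrite leq_pmulr.
apply: le_trans (h m m0 mq) _; rewrite ler_wpM2l // lef_pV2 ?posrE ?ltr0n ?n_gt0 //.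
by rewrite ler_nat leq_pmulr.
Qed.

Let lambda0 : 0 <= lambda. Proof. exact: ltW. Qed.

Lemma rate_cvg : (fun m => (m * q)%:R * occ_prob lambda (m * q)) @ \oo --> lambda.
Proof.
apply: (@cvg_grid _ _ (lambda ^+ 2 / 2)) => [|m m0 _]; first by rewrite divr_ge0 ?sqr_ge0.
by apply: occ_prob_rate => //; exact: n_gt0.
Qed.

Lemma half_rate_cvg :
  (fun m => (m * q)%:R * occ_prob lambda (m * q).*2) @ \oo --> lambda / 2.
Proof.
apply: (@cvg_grid _ _ (lambda ^+ 2 / 2)) => [|m m0 _]; first by rewrite divr_ge0 ?sqr_ge0.
have n0 := n_gt0 m0; have n20 : (0 < (m * q).*2)%N by rewrite double_gt0.
have := occ_prob_rate lambda_gt0 n20.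
have nR : 0 < (m * q)%:R :> R by rewrite ltr0n.
rewrite (_ : (m * q).*2%:R = 2 * (m * q)%:R :> R); last by rewrite -mul2n natrM.
set n := (m * q)%:R in nR *; set b := occ_prob _ _ => h.
have -> : n * b - lambda / 2 = (2 * n * b - lambda) / 2 by field.
rewrite normrM (ger0_norm (_ : 0 <= 2^-1)) ?invr_ge0 // ler_pdivrMr //.
apply: le_trans h _; rewrite -[leRHS]mulrA ler_wpM2l ?divr_ge0 ?sqr_ge0 //.
have nV : 0 < n^-1 by rewrite invr_gt0.
by rewrite invfM; lra.
Qed.

Lemma second_rate_cvg :
  (fun m => (m * q)%:R ^+ 2 * (occ_prob lambda (m * q) - lambda / (m * q)%:R)) @ \oo -->
  - (lambda ^+ 2 / 2).
Proof.
apply: (@cvg_grid _ _ (lambda ^+ 3 / 6)) => [|m m0 _]; first by rewrite divr_ge0 ?exprn_ge0.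
by apply: occ_prob_rate2 => //; exact: n_gt0.
Qed.

Lemma cvg_null_add (u v : nat -> R) (l C : R) : 0 <= C -> v @ \oo --> l ->
  (forall m, (0 < m)%N -> lambda <= (m * q)%:R -> `|u m - v m| <= C / (m * q)%:R) ->
  u @ \oo --> l.
Proof.
move=> C0 vl h.
have -> : u = (fun m => (u m - v m) + v m) by apply/funext => m; rewrite subrK.
rewrite -[l]add0r; apply: cvgD => //; apply: (cvg_grid C0) => m m0 mq.
by rewrite subr0; exact: h.
Qed.

(** The coefficient n b^2 / a tends to (lambda / 2)^2 / lambda. *)
Lemma refinement_cvg (V : R) : (fun m => mean_gain (m * q) (m * p)) @ \oo --> V ->
  (fun m => (m * q)%:R *
     (grid_scan (m.*2 * q) (m.*2 * p) - grid_scan (m * q) (m * p))) @ \oo -->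
  lambda / 4 * V.
Proof.
move=> GV.
pose r m := ((m * q)%:R * occ_prob lambda (m * q).*2) ^+ 2 *
  ((m * q)%:R * occ_prob lambda (m * q))^-1.
have rl : r @ \oo --> lambda / 4.
  have -> : lambda / 4 = (lambda / 2) ^+ 2 * lambda^-1 by field; rewrite lt0r_neq0.
  apply: cvgM.
    by rewrite expr2; under eq_fun do rewrite expr2; apply: cvgM; exact: half_rate_cvg.
  by apply: cvgV; [rewrite lt0r_neq0 | exact: rate_cvg].
apply: (@cvg_null_add _ (fun m => r m * mean_gain (m * q) (m * p)) _
  (lambda ^+ 4 / 2 + lambda ^+ 3)); first by rewrite addr_ge0 ?divr_ge0 ?exprn_ge0.
  exact: cvgM.
move=> m m0 _; have n0 := n_gt0 m0.
have L0 : (0 < m * p)%N by rewrite muln_gt0 m0.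
have := grid_scan_refine n0 L0; rewrite !doubleMl.
have nR : 0 < (m * q)%:R :> R by rewrite ltr0n.
rewrite /r -!doubleMl; set n := (m * q)%:R in nR *.
set a := occ_prob _ (m * q); set b := occ_prob _ _; set S := _ - grid_scan _ _.
set G := mean_gain _ _ => h.
have -> : n * S - (n * b) ^+ 2 * (n * a)^-1 * G = n * (S - b ^+ 2 / a * G).
  have nN := lt0r_neq0 nR; rewrite invfM; clearbody n; move: a^-1 => ai.
  by field.
rewrite normrM (gtr0_norm nR) -ler_pdivlMl //; apply: le_trans h _.
by rewrite expr2 invfM mulrA [leRHS]mulrC.
Qed.

Lemma crowd_with_nil m : bernE (fun=> occ_prob lambda (m * q)) (@crowd_with R p q k m [::])
  = grid_scan (m * q) (m * p).
Proof.
apply: eq_bernE => c; rewrite /crowd_with undup_id //; exact: sites_uniq.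
Qed.

Lemma crowd_with_cons m (i : 'I_(m * q)) c :
  @crowd_with R p q k m [:: val i] c = (crowded (nearn (m * p)) k (sites (i |: c)))%:R.
Proof.
congr (_ : bool)%:R; apply: crowded_perm; rewrite perm_sym; apply: perm_sites.
- exact: undup_uniq.
- by move=> j; rewrite mem_undup inE => /predU1P[->|]; [exact: ltn_ord | exact: sites_lt].
- by move=> j; rewrite mem_undup !inE mem_sites val_eqE.
Qed.

Lemma occ_prob_dist n : (0 < n)%N ->
  `|occ_prob lambda n - lambda / n%:R| <= (lambda ^+ 2 / 2) / n%:R ^+ 2.
Proof.
move=> n0; have nR : 0 < n%:R :> R by rewrite ltr0n.
have := occ_prob_rate lambda_gt0 n0.
have -> : n%:R * occ_prob lambda n - lambda = n%:R * (occ_prob lambda n - lambda / n%:R).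
  by field; rewrite lt0r_neq0.
rewrite normrM (gtr0_norm nR) -ler_pdivlMl // => /le_trans; apply.
by rewrite le_eqVlt; apply/orP; left; apply/eqP; field; rewrite lt0r_neq0.
Qed.

Definition grid_beta (n L : nat) : R := bernE (fun _ : 'I_n => lambda / n%:R)
  (fun c => (crowded (nearn L) k (sites c))%:R).

Definition mean_cons (m : nat) : R := (m * q)%:R^-1 * \sum_(i < m * q)
  bernE (fun=> occ_prob lambda (m * q)) (@crowd_with R p q k m [:: val i]).

(** By [bernE_russo] with a = lambda / n and a' = 1 - exp(-lambda / n). *)
Lemma grid_beta_cvg (I Al : R) :
  (fun m => grid_scan (m * q) (m * p)) @ \oo --> Al -> mean_cons @ \oo --> I ->
  (fun m => (m * q)%:R * (grid_scan (m * q) (m * p) - grid_beta (m * q) (m * p))) @ \oo -->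
  - (lambda ^+ 2 / 2) * (I - Al).
Proof.
move=> Acv Icv.
pose v m := ((m * q)%:R ^+ 2 * (occ_prob lambda (m * q) - lambda / (m * q)%:R)) *
  (mean_cons m - grid_scan (m * q) (m * p)).
apply: (@cvg_null_add _ v _ ((lambda ^+ 2 / 2) * (lambda ^+ 2 + lambda))).
- by rewrite mulr_ge0 ?divr_ge0 ?addr_ge0 ?sqr_ge0.
- by apply: cvgM; [exact: second_rate_cvg | exact: cvgB].
move=> m m0 mq; have n0 := n_gt0 m0.
have nR : 0 < (m * q)%:R :> R by rewrite ltr0n.
have x01 : 0 <= lambda / (m * q)%:R <= 1.
  by rewrite divr_ge0 //= ler_pdivrMr // mul1r.
have F01 (c : {set 'I_(m * q)}) : 0 <= ((crowded (nearn (m * p)) k (sites c))%:R : R) <= 1.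
  by case: crowded; rewrite ?lexx ?ler01.
have := bernE_russo x01 (occ_prob01 lambda_gt0 (m * q)) F01.
rewrite -/(grid_scan _ _) -/(grid_beta _ _).
have -> : \sum_i bernE (fun=> occ_prob lambda (m * q))
    (fun c : {set 'I_(m * q)} => (crowded (nearn (m * p)) k (sites (i |: c)))%:R) =
    (m * q)%:R * mean_cons m.
  rewrite /mean_cons mulVKf ?lt0r_neq0 //; apply: eq_bigr => i _.
  by apply: eq_bernE => c; rewrite crowd_with_cons.
have := occ_prob_dist n0; have := occ_prob_le lambda (m * q).
have /andP[a0 _] := occ_prob01 lambda_gt0 (m * q).
have nN := lt0r_neq0 nR.
rewrite /v; move: (grid_scan _ _) (grid_beta _ _) (mean_cons m) => A B S.
move: ((m * q)%:R : R) nR nN x01 mq (occ_prob _ _) a0 => n nR nN x01 mq a a0 a_le dist h.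
have -> : n * (A - B) - n ^+ 2 * (a - lambda / n) * (S - A) =
    n * (A - B - (a - lambda / n) * (n * S - n * A)) by ring.
rewrite normrM (gtr0_norm nR).
apply: le_trans (ler_wpM2l (ltW nR) h) _.
set D := `|_| in dist h *.
have D0 : 0 <= D by exact: normr_ge0.
have dist2 : n * (n * D) <= lambda ^+ 2 / 2.
  by rewrite mulrA -expr2 mulrC -ler_pdivlMr // exprn_gt0.
have nD : 2 * n * D + a <= (lambda ^+ 2 + lambda) / n.
  rewrite ler_pdivlMr //; have : a * n <= lambda by rewrite -ler_pdivlMr.
  lra.
have -> : n * (D * (n * (2 * n * D + a))) = n * (n * D) * (2 * n * D + a) by ring.
have n0' := ltW nR; rewrite -[leRHS]mulrA; apply: ler_pM => //.
  by rewrite !mulr_ge0.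
by rewrite addr_ge0 // !mulr_ge0.
Qed.

(** The difference Al - beta_n is split at [grid_scan]. *)
Lemma real_limit (Al V I : R) :
  (fun m => grid_scan (m * q) (m * p)) @ \oo --> Al ->
  (fun m => mean_gain (m * q) (m * p)) @ \oo --> V ->
  mean_cons @ \oo --> I ->
  (fun m => 2 * (m * q)%:R / lambda ^+ 2 * (Al - grid_beta (m * q) (m * p))) @ \oo -->
  lambda^-1 * V + Al - I.
Proof.
move=> Acv Vcv Icv.
have h1 := grid_beta_cvg Acv Icv.
have h2 : (fun m => (m * q)%:R * (Al - grid_scan (m * q) (m * p))) @ \oo -->
    2 * (lambda / 4 * V).
  apply: (@halving_limit _ (fun m => grid_scan (m * q) (m * p)) (fun m => (m * q)%:R)) => //.
  - by move=> m; rewrite -doubleMl -mul2n natrM.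
  - by move=> m m0; rewrite ltr0n n_gt0.
  - exact: refinement_cvg.
have -> : lambda^-1 * V + Al - I = 2 / lambda ^+ 2 *
    (2 * (lambda / 4 * V) + - (lambda ^+ 2 / 2) * (I - Al)).
  by field; rewrite lt0r_neq0.
rewrite (_ : (fun m => _) = (fun m => 2 / lambda ^+ 2 *
   ((m * q)%:R * (Al - grid_scan (m * q) (m * p)) +
    (m * q)%:R * (grid_scan (m * q) (m * p) - grid_beta (m * q) (m * p))))).
  by apply: cvgM; [exact: cvg_cst | exact: cvgD].
apply/funext => m; rewrite -mulrDr addrA subrK; ring.
Qed.

End assembly.

(** * Passage to the extended reals *)

Theorem theorem2p2 (R : realType) (d : measure_display) (T : measurableType d)
  (P : probability T R) (lambda : R) (p q k : nat)
  (Pi : T -> seq R) (H : nat -> nat -> T -> nat)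
  (hlambda : 0 < lambda)
  (hp : (0 < p)%N) (hpq : (p < q)%N) (hcop : coprime p q) (hk : (2 <= k)%N)
  (hPi : poisson_process P lambda Pi)
  (hH : forall m : nat, lambda <= (m * q)%:R ->
     iid_bernoulli P (m * q) (lambda / (m * q)%:R) (H (m * q)%N)) :
  let w : R := p%:R / q%:R in
  (fun m : nat => ((2 * (m * q)%:R / lambda ^+ 2)%:E *
     (alpha P Pi w k - beta P (m * q) (m * p) k (H (m * q)%N)))%E) @ \oo -->
  ((lambda^-1)%:E * 'E_P[fun x => (nu w k (Pi x) + nu_tilde w k (Pi x))%:R]
   + alpha P Pi w k
   - \int[lebesgue_measure]_(u in `[0%R, 1%R])
       P [set x | (k <= scan w (u :: Pi x))%N])%E.
Proof.
move=> w.
have p_lt : (p < q)%N := hpq.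
have q_gt0 : (0 < q)%N := leq_ltn_trans (leq0n p) hpq.
have k_gt0 : (0 < k)%N := ltnW hk.
have scan01 m : 0 <= grid_scan lambda k (m * q) (m * p) <= 1.
  by rewrite -crowd_with_nil; exact: crowd_with_itv01.
have scanE : (fun m => (grid_scan lambda k (m * q) (m * p))%:E) @ \oo --> alpha P Pi w k.
  by under eq_fun do rewrite -crowd_with_nil; exact: scan_cvg.
have [alphaE alpha_cvg] := bounded_ecvg scan01 scanE.
have gain01 m : 0 <= mean_gain lambda k (m * q) (m * p) <= (2 * (q * k))%:R.
  have a01 : forall i : 'I_(m * q), 0 <= occ_prob lambda (m * q) <= 1.
    by move=> _; exact: occ_prob01.
  rewrite -[X in X <= _](bernE_cst (fun _ : 'I_(m * q) => occ_prob lambda (m * q))).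
  rewrite -[X in _ && (_ <= X)](bernE_cst (fun _ : 'I_(m * q) => occ_prob lambda (m * q))).
  apply/andP; split; apply: le_bernE => // c.
  rewrite ler_nat; apply: total_gain_le => //; first exact: sites_uniq.
  by move=> i; exact: sites_lt.
have [gainE gain_cv] := bounded_ecvg gain01 (gain_cvg hlambda hPi hp hpq hk).
have mean01 m : 0 <= mean_cons lambda p q k m <= 1.
  have y01 i := crowd_with_itv01 hlambda p q k m [:: i].
  rewrite /mean_cons mulr_ge0 ?invr_ge0 ?sumr_ge0 //=; last by move=> i _; case/andP: (y01 i).
  have [mq|mq] := posnP (m * q)%N.
    by rewrite [(m * q)%:R](_ : _ = 0 :> R) ?invr0 ?mul0r ?ler01 // mq.
  rewrite ler_pdivrMl ?ltr0n // mulr1 -[X in _ <= X%:R]card_ord -sum1_card natr_sum.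
  by apply: ler_sum => i _; case/andP: (y01 i).
have [meanE mean_cv] := bounded_ecvg mean01 (mean_cons_cvg hlambda hPi hp hpq hk).
have main := real_limit hlambda hPi hp hpq alpha_cvg gain_cv mean_cv.
rewrite gainE meanE alphaE -!EFinM -!EFinD.
have beta_near : \forall m \near \oo,
    ((2 * (m * q)%:R / lambda ^+ 2 *
       (fine (alpha P Pi w k) - grid_beta lambda k (m * q) (m * p)))%:E =
    (2 * (m * q)%:R / lambda ^+ 2)%:E *
      ((fine (alpha P Pi w k))%:E - beta P (m * q) (m * p) k (H (m * q)%N)))%E.
  exists (Num.bound lambda) => // m /= lm.
  have mq : lambda <= (m * q)%:R.
    apply: ltW (lt_le_trans (archi_boundP (ltW hlambda)) _); rewrite ler_nat.
    by apply: leq_trans lm _; rewrite leq_pmulr.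
  rewrite (beta_law (hH m mq)) ?leq_mul2l ?(ltnW hpq) ?orbT //.
apply: cvg_trans (near_eq_cvg beta_near) _.
apply: cvg_EFin; [exact: nearW | exact: main].
Qed.
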